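(* Let $K$ be a simplicial complex on $n$ vertices and let $SK_1$ be the 1-skeleton of $K$. Let $G_1,\dots,G_n$ be discrete groups. Then $$\pi_1(Z_K(\underline{BG}))\cong \pi_1(Z_{SK_1}(\underline{BG}))\cong \prod_{SK_1}G_i,$$ where $\prod_{SK_1}G_i$ is the graph product of $G_1,\dots,G_n$ over the graph $SK_1$.
   Context: A simplicial complex $K$ on $n$ vertices is a collection of subsets of $[n]=\{1,\dots,n\}$, closed under taking subsets, containing $\varnothing$ and every singleton $\{i\}$. Its 1-skeleton $SK_1$ consists of the simplices of $K$ with at most two vertices, and is regarded as a simplicial graph with vertex set $[n]$. For pointed CW-pairs $(\underline X,\underline A)=\{(X_i,A_i)\}_{i=1}^n$, the polyhedral product is $$Z_K(\underline X,\underline A)=\bigcup_{\sigma\in K}D(\sigma)\subseteq \prod_{i=1}^n X_i,\qquad D(\sigma)=\prod_{i=1}^n Y_i,\quad Y_i=X_i \text{ if } i\in\sigma,\ Y_i=A_i\text{ if } i\notin\sigma.$$ For discrete groups $G_1,\dots,G_n$, $Z_K(\underline{BG})$ denotes $Z_K$ of the pairs $\{(BG_i,\ast_i)\}_{i=1}^n$, where $BG_i$ is the classifying space of $G_i$ (a CW-complex) with basepoint $\ast_i$. Graph product: for a simplicial graph $\Gamma$ with vertex set $S$ and groups $\{G_s\}_{s\in S}$, $\prod_\Gamma G_s$ is the quotient of the free product of the $G_s$ by the relations that elements of $G_s$ and $G_t$ commute whenever $\{s,t\}$ is an edge of $\Gamma$. *)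

(* Defs.v *)
From HB Require Import structures.
From mathcomp Require Import all_boot all_order all_algebra.
From mathcomp Require Import all_classical reals topology normedtype.
From mathcomp Require Import continuous_path lra.

Set Implicit Arguments.
Unset Strict Implicit.
Unset Printing Implicit Defensive.

Import Order.TTheory GRing.Theory Num.Theory.
Import numFieldTopology.Exports numFieldNormedType.Exports.

Local Open Scope classical_set_scope.
Local Open Scope ring_scope.
Local Open Scope quotient_scope.

Section PropQuotient.
Variables (T : Type) (r : T -> T -> Prop).
Hypotheses (r_refl : forall x, r x x) (r_sym : forall x y, r x y -> r y x)
  (r_trans : forall y x z, r x y -> r y z -> r x z).

Let asb_refl : reflexive (fun x y => `[< r x y >]).
Proof. by move=> x; apply/asboolP. Qed.

Let asb_sym : symmetric (fun x y => `[< r x y >]).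
Proof. by move=> x y; apply/asboolP/asboolP; apply: r_sym. Qed.

Let asb_trans : transitive (fun x y => `[< r x y >]).
Proof. by move=> y x z /asboolP xy /asboolP yz; apply/asboolP; apply: r_trans yz. Qed.

Definition equiv_of_Prop : equiv_rel T := EquivRel _ asb_refl asb_sym asb_trans.

End PropQuotient.

Definition unit_interval (R : realType) : Type := `[0 : R, 1]%classic.

HB.instance Definition _ (R : realType) :=
  Topological.copy (unit_interval R) (set_type `[0 : R, 1]%classic).

Section UnitInterval.
Variable R : realType.
Local Notation I := (unit_interval R).

Definition ival (t : I) : R := val t.

Definition clamp01 (r : R) : R := Num.max 0 (Num.min r 1).

Lemma clamp01_itv r : clamp01 r \in `[0 : R, 1]%classic.
Proof.
by rewrite inE /= in_itv /= le_max lexx ge_max ler01 ge_min lexx orbT.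
Qed.

Definition clamp (r : R) : I := exist _ (clamp01 r) (clamp01_itv r).

Lemma ival_inj : injective ival. Proof. exact: val_inj. Qed.

Lemma ival_ge0 t : 0 <= ival t.
Proof. by case: t => r; rewrite /ival /= inE /= in_itv /= => /andP[]. Qed.

Lemma ival_le1 t : ival t <= 1.
Proof. by case: t => r; rewrite /ival /= inE /= in_itv /= => /andP[]. Qed.

Lemma clampK r : 0 <= r <= 1 -> ival (clamp r) = r.
Proof.
by rewrite /ival /= /clamp01 => /andP[r0 r1]; rewrite min_l // max_r.
Qed.

Lemma ivalK t : clamp (ival t) = t.
Proof. by apply: ival_inj; rewrite clampK // ival_ge0 ival_le1. Qed.

Lemma ival_continuous : continuous ival.
Proof. exact: initial_continuous. Qed.

Lemma clamp_continuous : continuous clamp.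
Proof.
apply: continuous_comp_initial => x.
apply: (@continuous_max R R (fun=> 0) (fun r => Num.min r 1)); first exact: cvg_cst.
apply: (@continuous_min R R id (fun=> 1)); [exact: cvg_id|exact: cvg_cst].
Qed.

Let zero_one_neq : clamp 0 != clamp 1.
Proof.
apply/eqP => /(congr1 ival); rewrite !clampK ?lexx ?ler01 //.
by move/eqP; rewrite eq_sym oner_eq0.
Qed.

HB.instance Definition _ := isBiPointed.Build I zero_one_neq.

Lemma ival0 : ival (zero : I) = 0. Proof. by rewrite clampK // lexx ler01. Qed.
Lemma ival1 : ival (one : I) = 1. Proof. by rewrite clampK // lexx ler01. Qed.

Lemma glue_continuous (T X : topologicalType) (h : T -> R) (f g : T -> X) :
  continuous h -> continuous f -> continuous g ->
  (forall t, h t = 0 -> f t = g t) ->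
  continuous (fun t => if h t <= 0 then f t else g t).
Proof.
move=> ch cf cg fg; apply/continuous_subspace_setT.
have -> : [set: T] = h @^-1` [set x | x <= 0] `|` h @^-1` [set x | 0 <= x].
  by apply/seteqP; split => // t _ /=; apply/orP; exact: le_total.
apply: withinU_continuous.
- by apply: closed_comp => [t _|]; [exact: ch|exact: closed_le].
- by apply: closed_comp => [t _|]; [exact: ch|exact: closed_ge].
- apply: (@subspace_eq_continuous _ _ _ f); last exact: continuous_subspaceT.
  by move=> t; rewrite inE /= /from_subspace /= => ->.
apply: (@subspace_eq_continuous _ _ _ g); last exact: continuous_subspaceT.
move=> t; rewrite inE /= /from_subspace /= => h0; case: ifP => // h1.
by rewrite fg //; apply/eqP; rewrite eq_le h0 h1.
Qed.

End UnitInterval.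

Section Homotopy.
Variables (R : realType) (X : topologicalType).
Local Notation I := (unit_interval R).
Implicit Types x y z : X.

Definition path_homotopy x y (f g : I -> X) (H : I * I -> X) : Prop :=
  [/\ continuous H, forall s, H (s, zero) = f s, forall s, H (s, one) = g s,
      forall t, H (zero, t) = x & forall t, H (one, t) = y].

Definition path_homotopic x y (p q : {path I from x to y}) : Prop :=
  exists H, path_homotopy x y p q H.

Lemma path_homotopic_refl x y (p : {path I from x to y}) : path_homotopic p p.
Proof.
exists (p \o fst); split => //= [|_|_]; [|exact: path_zero|exact: path_one].
by move=> z; apply: continuous_comp; [exact: cvg_fst|exact: cts_fun].
Qed.

Let continuous_ival_snd : continuous (fun st : I * I => ival st.2).
Proof. by move=> z; apply: continuous_comp; [exact: cvg_snd|exact: ival_continuous]. Qed.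

Let continuous_ival_fst : continuous (fun st : I * I => ival st.1).
Proof. by move=> z; apply: continuous_comp; [exact: cvg_fst|exact: ival_continuous]. Qed.

Lemma clamp_comp_continuous (T : topologicalType) (h : T -> R) :
  continuous h -> continuous (fun t => clamp (h t)).
Proof. by move=> ch t; apply: continuous_comp; [exact: ch|exact: clamp_continuous]. Qed.

Lemma comp_clamp_continuous (T : topologicalType) (f : I -> X) (h : T -> R) :
  continuous f -> continuous h -> continuous (fun t => f (clamp (h t))).
Proof.
move=> cf ch t.
by apply: (@continuous_comp _ _ _ (fun t => clamp (h t)) f);
  [exact: clamp_comp_continuous|exact: cf].
Qed.

Let affine_continuous (T : topologicalType) (h : T -> R) (a b : R) :
  continuous h -> continuous (fun t => a * h t + b).
Proof. by move=> ch t; apply: cvgD; [apply: cvgM; [exact: cvg_cst|exact: ch]|exact: cvg_cst]. Qed.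

Let slide (H : I * I -> X) (k1 k2 : I * I -> I) :
  continuous H -> continuous k1 -> continuous k2 ->
  continuous (H \o fun st => (k1 st, k2 st)).
Proof.
move=> cH c1 c2 st.
apply: (@continuous_comp _ _ _ (fun st => (k1 st, k2 st))); last exact: cH.
exact: (cvg_pair (c1 st) (c2 st)).
Qed.

Lemma path_homotopic_sym x y (p q : {path I from x to y}) :
  path_homotopic p q -> path_homotopic q p.
Proof.
move=> [H [cH H0 H1 Hx Hy]].
exists (H \o fun st => (st.1, clamp ((-1) * ival st.2 + 1))); split => /=.
- apply: slide => //; first by move=> z; exact: cvg_fst.
  exact/clamp_comp_continuous/affine_continuous.
- by move=> s; rewrite ival0 mulr0 add0r H1.
- by move=> s; rewrite ival1 mulr1 addNr H0.
- by move=> t; rewrite Hx.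
- by move=> t; rewrite Hy.
Qed.

Lemma path_homotopic_trans x y (q p r : {path I from x to y}) :
  path_homotopic p q -> path_homotopic q r -> path_homotopic p r.
Proof.
move=> [H [cH H0 H1 Hx Hy]] [K [cK K0 K1 Kx Ky]].
exists (fun st => if 2 * ival st.2 + (-1) <= 0
  then (H \o fun st => (st.1, clamp (2 * ival st.2 + 0))) st
  else (K \o fun st => (st.1, clamp (2 * ival st.2 + (-1)))) st); split => /=.
- apply: glue_continuous.
  + exact/affine_continuous.
  + apply: slide => //; first by move=> z; exact: cvg_fst.
    exact/clamp_comp_continuous/affine_continuous.
  + apply: slide => //; first by move=> z; exact: cvg_fst.
    exact/clamp_comp_continuous/affine_continuous.
  + move=> [s t] /= E; rewrite E (_ : 2 * ival t + 0 = 1); last by lra.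
    by rewrite K0 H1.
- by move=> s; rewrite ival0 ifT ?mulr0 ?addr0 ?H0 //; lra.
- move=> s; rewrite ival1 ifF; last by apply/negP; lra.
  by rewrite (_ : 2 * 1 + -1 = 1 :> R) ?K1 //; lra.
- by move=> t; rewrite Hx Kx if_same.
- by move=> t; rewrite Hy Ky if_same.
Qed.

Lemma reparam_homotopy x y (f : I -> X) (u v : I -> R) :
  continuous f -> continuous u -> continuous v ->
  u zero = v zero -> u one = v one ->
  f (clamp (u zero)) = x -> f (clamp (u one)) = y ->
  exists H, path_homotopy x y (fun s => f (clamp (u s))) (fun s => f (clamp (v s))) H.
Proof.
move=> cf cu cv uv0 uv1 fx fy.
exists (fun st => f (clamp (u st.1 + ival st.2 * (v st.1 - u st.1)))); split => /=.
- move=> z; apply: continuous_comp; last exact: cf.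
  have cw w : continuous w -> continuous (fun st : I * I => w st.1 : R).
    by move=> c st; apply: continuous_comp; [exact: cvg_fst|exact: c].
  apply: clamp_comp_continuous => {}z.
  apply: cvgD; first exact: cw.
  apply: cvgM; first exact: continuous_ival_snd.
  by apply: cvgB; exact: cw.
- by move=> s; rewrite ival0 mul0r addr0.
- by move=> s; rewrite ival1 mul1r addrC subrK.
- by move=> t; rewrite -uv0 subrr mulr0 addr0.
- by move=> t; rewrite -uv1 subrr mulr0 addr0.
Qed.

Definition concat_fun (f g : I -> X) (s : I) : X :=
  if 2 * ival s - 1 <= 0 then f (clamp (2 * ival s)) else g (clamp (2 * ival s - 1)).

Definition rev_fun (f : I -> X) (s : I) : X := f (clamp (1 - ival s)).

Lemma concat_clampL f g r : 0 <= r -> 2 * r <= 1 ->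
  concat_fun f g (clamp r) = f (clamp (2 * r)).
Proof. by move=> r0 r1; rewrite /concat_fun clampK ?ifT //; lra. Qed.

Lemma concat_clampR f g r : 1 < 2 * r -> r <= 1 ->
  concat_fun f g (clamp r) = g (clamp (2 * r - 1)).
Proof.
move=> r0 r1; rewrite /concat_fun clampK ?ifF //; last by lra.
by apply/negP; lra.
Qed.

Section Operations.
Variables x y z : X.

Lemma concat_continuous (p : {path I from x to y}) (q : {path I from y to z}) :
  continuous (concat_fun p q).
Proof.
have c2 : continuous (fun s : I => 2 * ival s).
  by move=> s; apply: (cvgM (cvg_cst _) (@ival_continuous R s)).
have c21 : continuous (fun s : I => 2 * ival s - 1).
  by move=> s; apply: (cvgB (c2 s) (cvg_cst _)).
apply: glue_continuous => //.
- by apply: comp_clamp_continuous => //; exact: cts_fun.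
- by apply: comp_clamp_continuous => //; exact: cts_fun.
- move=> s E; rewrite E (_ : 2 * ival s = 1); last by lra.
  by rewrite -[clamp 1]/one -[clamp 0]/zero path_zero path_one.
Qed.

Lemma concat_zero (p : {path I from x to y}) (q : {path I from y to z}) :
  concat_fun p q zero = x.
Proof.
by rewrite /concat_fun ival0 mulr0 ifT; [exact: path_zero|lra].
Qed.

Lemma concat_one (p : {path I from x to y}) (q : {path I from y to z}) :
  concat_fun p q one = z.
Proof.
rewrite /concat_fun ival1 mulr1 ifF; last by apply/negP; lra.
by rewrite (_ : 2 - 1 = 1 :> R); [exact: path_one|lra].
Qed.

Definition concat (p : {path I from x to y}) (q : {path I from y to z}) :
    {path I from x to z} :=
  mk_path (@concat_continuous p q) (concat_zero p q) (concat_one p q).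

Lemma rev_continuous (p : {path I from x to y}) : continuous (rev_fun p).
Proof.
apply: comp_clamp_continuous; first exact: cts_fun.
move=> s; exact: (cvgB (cvg_cst _) (@ival_continuous R s)).
Qed.

Lemma rev_zero (p : {path I from x to y}) : rev_fun p zero = y.
Proof. by rewrite /rev_fun ival0 subr0; exact: path_one. Qed.

Lemma rev_one (p : {path I from x to y}) : rev_fun p one = x.
Proof. by rewrite /rev_fun ival1 subrr; exact: path_zero. Qed.

Definition rev_path (p : {path I from x to y}) : {path I from y to x} :=
  mk_path (@rev_continuous p) (rev_zero p) (rev_one p).

Definition cst_loop : {path I from x to x} := cst x.

End Operations.

Lemma concat_homotopic x y z (p p' : {path I from x to y})
    (q q' : {path I from y to z}) :
  path_homotopic p p' -> path_homotopic q q' ->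
  path_homotopic (concat p q) (concat p' q').
Proof.
move=> [H [cH H0 H1 Hx Hy]] [K [cK K0 K1 Kx Ky]].
exists (fun st => if 2 * ival st.1 + (-1) <= 0
  then (H \o fun st => (clamp (2 * ival st.1 + 0), st.2)) st
  else (K \o fun st => (clamp (2 * ival st.1 + (-1)), st.2)) st); split => /=.
- apply: glue_continuous.
  + exact/affine_continuous.
  + apply: slide => //; last by move=> w; exact: cvg_snd.
    exact/clamp_comp_continuous/affine_continuous.
  + apply: slide => //; last by move=> w; exact: cvg_snd.
    exact/clamp_comp_continuous/affine_continuous.
  + move=> [s t] /= E; rewrite E (_ : 2 * ival s + 0 = 1); last by lra.
    by rewrite Hy Kx.
- by move=> s; rewrite H0 K0 addr0.
- by move=> s; rewrite H1 K1 addr0.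
- by move=> t; rewrite ival0 ifT ?mulr0 ?addr0 ?Hx //; lra.
- move=> t; rewrite ival1 ifF; last by apply/negP; lra.
  by rewrite (_ : 2 * 1 + -1 = 1 :> R) ?Ky //; lra.
Qed.

Lemma rev_homotopic x y (p q : {path I from x to y}) :
  path_homotopic p q -> path_homotopic (rev_path p) (rev_path q).
Proof.
move=> [H [cH H0 H1 Hx Hy]].
exists (H \o fun st => (clamp ((-1) * ival st.1 + 1), st.2)); split => /=.
- apply: slide => //; last by move=> w; exact: cvg_snd.
  exact/clamp_comp_continuous/affine_continuous.
- by move=> s; rewrite H0 mulN1r addrC.
- by move=> s; rewrite H1 mulN1r addrC.
- by move=> t; rewrite ival0 mulr0 add0r Hy.
- by move=> t; rewrite ival1 mulr1 addNr Hx.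
Qed.

Lemma concatA x y z w (p : {path I from x to y}) (q : {path I from y to z})
    (r : {path I from z to w}) :
  path_homotopic (concat p (concat q r)) (concat (concat p q) r).
Proof.
pose v (s : I) : R := Num.min (Num.min (2 * ival s + 0) (1 * ival s + 4^-1))
  (2^-1 * ival s + 2^-1).
have ca a b : continuous (fun s : I => a * ival s + b).
  exact/affine_continuous/ival_continuous.
have cv : continuous v.
  move=> s; apply: (@continuous_min R I
    (fun s => Num.min (2 * ival s + 0) (1 * ival s + 4^-1))
    (fun s => 2^-1 * ival s + 2^-1)); last exact: ca.
  by apply: (@continuous_min R I (fun s => 2 * ival s + 0)
    (fun s => 1 * ival s + 4^-1)); exact: ca.
have v0 : v zero = 0 by rewrite /v ival0 [X in Num.min X _]min_l ?min_l; lra.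
have v1 : v one = 1 by rewrite /v ival1 [X in Num.min X _]min_r ?min_r; lra.
have [||||H hH] := @reparam_homotopy x w _ (@ival R) v
  (@concat_continuous _ _ _ p (concat q r)) (@ival_continuous R) cv.
- by rewrite v0 ival0.
- by rewrite v1 ival1.
- by rewrite ival0; exact: (concat_zero p (concat q r)).
- by rewrite ival1; exact: (concat_one p (concat q r)).
have [cH H0 H1 Hx Hy] := hH.
exists H; split => // s; first by rewrite H0 ivalK.
rewrite H1 /=.
have := ival_ge0 s; have := ival_le1 s => s1 s0.
have vE : v s = if 4 * ival s <= 1 then 2 * ival s else
   if 2 * ival s <= 1 then ival s + 4^-1 else 2^-1 * ival s + 2^-1.
  rewrite /v; case: (leP (2 * ival s + 0) (1 * ival s + 4^-1)) => ?;
    case: (leP _ (2^-1 * ival s + 2^-1)) => ?;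
    by case: ifPn; last case: ifPn; rewrite -?ltNge; lra.
apply: esym; rewrite -[LHS]/(concat_fun (concat_fun p q) r s).
rewrite -[RHS]/(concat_fun p (concat_fun q r) (clamp (v s))) vE.
rewrite -[s in LHS]ivalK.
case: ifPn; last case: ifPn; rewrite -?ltNge.
- move=> ?; rewrite concat_clampL; [|lra|lra]; rewrite concat_clampL; [|lra|lra].
  rewrite concat_clampL; [|lra|lra]; congr (p (clamp _)); lra.
- move=> ? ?; rewrite concat_clampL; [|lra|lra]; rewrite concat_clampR; [|lra|lra].
  rewrite concat_clampR; [|lra|lra]; rewrite concat_clampL; [|lra|lra].
  congr (q (clamp _)); lra.
- move=> ? ?; rewrite concat_clampR; [|lra|lra]; rewrite concat_clampR; [|lra|lra].
  rewrite concat_clampR; [|lra|lra]; congr (r (clamp _)); lra.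
Qed.

Let affine_ival_continuous (a b : R) : continuous (fun s : I => a * ival s + b).
Proof. exact/affine_continuous/ival_continuous. Qed.

Lemma concat1p x y (p : {path I from x to y}) :
  path_homotopic (concat (cst_loop x) p) p.
Proof.
pose u (s : I) := Num.max 0 (2 * ival s + -1).
have cu : continuous u.
  move=> s; apply: (@continuous_max R I (fun=> 0) (fun s => 2 * ival s + -1)).
    exact: (@cst_continuous I R 0 s).
  exact: affine_ival_continuous.
have u0 : u zero = 0 by rewrite /u ival0 max_l //; lra.
have u1 : u one = 1 by rewrite /u ival1 max_r //; lra.
have [||||H [cH H0 H1 Hx Hy]] := @reparam_homotopy x y p u (@ival R)
  (@cts_fun _ _ p) cu (@ival_continuous R).
- by rewrite u0 ival0.
- by rewrite u1 ival1.
- by rewrite u0; exact: path_zero.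
- by rewrite u1; exact: path_one.
exists H; split => // s; last by rewrite H1 ivalK.
rewrite H0 -[RHS]/(concat_fun (cst x) p s) -[s in RHS]ivalK /u.
have := ival_ge0 s; have := ival_le1 s => s1 s0.
case: leP => ?.
  case: (leP (2 * ival s) 1) => ?; last by rewrite concat_clampR.
  rewrite concat_clampL // (_ : 2 * ival s + -1 = 0); first exact: path_zero.
  by lra.
by rewrite concat_clampL //; [exact: path_zero|lra].
Qed.

Lemma concatp1 x y (p : {path I from x to y}) :
  path_homotopic (concat p (cst_loop y)) p.
Proof.
pose u (s : I) := Num.min 1 (2 * ival s + 0).
have cu : continuous u.
  move=> s; apply: (@continuous_min R I (fun=> 1) (fun s => 2 * ival s + 0)).
    exact: (@cst_continuous I R 1 s).
  exact: affine_ival_continuous.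
have u0 : u zero = 0 by rewrite /u ival0 min_r //; lra.
have u1 : u one = 1 by rewrite /u ival1 min_l //; lra.
have [||||H [cH H0 H1 Hx Hy]] := @reparam_homotopy x y p u (@ival R)
  (@cts_fun _ _ p) cu (@ival_continuous R).
- by rewrite u0 ival0.
- by rewrite u1 ival1.
- by rewrite u0; exact: path_zero.
- by rewrite u1; exact: path_one.
exists H; split => // s; last by rewrite H1 ivalK.
rewrite H0 -[RHS]/(concat_fun p (cst y) s) -[s in RHS]ivalK /u addr0.
have := ival_ge0 s; have := ival_le1 s => s1 s0.
case: (leP (2 * ival s) 1) => ?.
  by rewrite concat_clampL.
by rewrite concat_clampR //; exact: path_one.
Qed.

Lemma concatpV x y (p : {path I from x to y}) :
  path_homotopic (concat p (rev_path p)) (cst_loop x).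
Proof.
pose u (s : I) := Num.min (2 * ival s + 0) ((-2) * ival s + 2).
have cu : continuous u.
  by move=> s; apply: (@continuous_min R I (fun s => 2 * ival s + 0)
    (fun s => (-2) * ival s + 2)); exact: affine_ival_continuous.
have u0 : u zero = 0 by rewrite /u ival0 min_l; lra.
have u1 : u one = 0 by rewrite /u ival1 min_r; lra.
have [||||H [cH H0 H1 Hx Hy]] := @reparam_homotopy x x p u (fun=> 0)
  (@cts_fun _ _ p) cu (@cst_continuous I R 0).
- by rewrite u0.
- by rewrite u1.
- by rewrite u0; exact: path_zero.
- by rewrite u1; exact: path_zero.
exists H; split => // s; last by rewrite H1; exact: path_zero.
rewrite H0 -[RHS]/(concat_fun p (rev_fun p) s) -[s in RHS]ivalK /u.
have := ival_ge0 s; have := ival_le1 s => s1 s0.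
case: (leP (2 * ival s) 1) => ?.
  rewrite concat_clampL // min_l; [congr (p (clamp _)); lra|lra].
rewrite concat_clampR // /rev_fun clampK; last by lra.
by rewrite min_r; [congr (p (clamp _)); lra|lra].
Qed.

Lemma concatVp x y (p : {path I from x to y}) :
  path_homotopic (concat (rev_path p) p) (cst_loop y).
Proof.
apply: path_homotopic_trans (concatpV (rev_path p)).
apply: concat_homotopic; first exact: path_homotopic_refl.
suff -> : rev_path (rev_path p) = p by exact: path_homotopic_refl.
apply/path_eqP => s; rewrite -[LHS]/(rev_fun (rev_fun p) s) /rev_fun.
have := ival_ge0 s; have := ival_le1 s => s1 s0.
by rewrite clampK ?subKr ?ivalK //; lra.
Qed.

End Homotopy.

Section FundamentalGroup.
Variables (R : realType) (X : topologicalType) (x : X).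
Local Notation loop := {path unit_interval R from x to x}.

Definition loop_equiv : equiv_rel loop :=
  equiv_of_Prop (@path_homotopic_refl R X x x) (@path_homotopic_sym R X x x)
    (@path_homotopic_trans R X x x).

Definition pi1 : Type := {eq_quot loop_equiv}.

HB.instance Definition _ := Choice.on pi1.

Definition pi1_class (p : loop) : pi1 := \pi_{eq_quot loop_equiv} p.

Lemma pi1_classP p q : pi1_class p = pi1_class q <-> path_homotopic p q.
Proof. by split => [/eqmodP/asboolP|/asboolP pq]; last exact/eqmodP. Qed.

Lemma pi1_ind (P : pi1 -> Prop) : (forall p, P (pi1_class p)) -> forall a, P a.
Proof. by move=> Pp a; rewrite -[a]reprK; exact: Pp. Qed.

Let rep (a : pi1) : loop := repr (a : {eq_quot loop_equiv}).

Lemma pi1_repK a : pi1_class (rep a) = a. Proof. exact: reprK. Qed.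

Definition pi1_one : pi1 := pi1_class (cst_loop R x).
Definition pi1_mul (a b : pi1) : pi1 := pi1_class (concat (rep a) (rep b)).
Definition pi1_inv (a : pi1) : pi1 := pi1_class (rev_path (rep a)).

Lemma pi1_mulE p q : pi1_mul (pi1_class p) (pi1_class q) = pi1_class (concat p q).
Proof. by apply/pi1_classP/concat_homotopic; apply/pi1_classP; exact: pi1_repK. Qed.

Lemma pi1_invE p : pi1_inv (pi1_class p) = pi1_class (rev_path p).
Proof. by apply/pi1_classP/rev_homotopic; apply/pi1_classP; exact: pi1_repK. Qed.

Let pi1_mulA : associative pi1_mul.
Proof.
elim/pi1_ind => p; elim/pi1_ind => q; elim/pi1_ind => r.
by rewrite !pi1_mulE; apply/pi1_classP; exact: concatA.
Qed.

Let pi1_mul1 : left_id pi1_one pi1_mul.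
Proof. by elim/pi1_ind => p; rewrite pi1_mulE; apply/pi1_classP; exact: concat1p. Qed.

Let pi1_mulr1 : right_id pi1_one pi1_mul.
Proof. by elim/pi1_ind => p; rewrite pi1_mulE; apply/pi1_classP; exact: concatp1. Qed.

Let pi1_mulV : left_inverse pi1_one pi1_inv pi1_mul.
Proof.
by elim/pi1_ind => p; rewrite pi1_invE pi1_mulE; apply/pi1_classP; exact: concatVp.
Qed.

Let pi1_mulrV : right_inverse pi1_one pi1_inv pi1_mul.
Proof.
by elim/pi1_ind => p; rewrite pi1_invE pi1_mulE; apply/pi1_classP; exact: concatpV.
Qed.

HB.instance Definition _ :=
  isGroup.Build pi1 pi1_mulA pi1_mul1 pi1_mulr1 pi1_mulV pi1_mulrV.

End FundamentalGroup.

Definition group_isomorphic (G H : groupType) : Prop :=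
  exists f : {multiplicative G -> H}, bijective f.

Section FreeProduct.
Variables (S : choiceType) (G : S -> groupType).

Definition syllable (s : S) (g : G s) : {s : S & G s} := Tagged (fun s => G s) g.

(* The free product is realized on all words of syllables, not on reduced ones. *)
Inductive word_equiv : seq {s : S & G s} -> seq {s : S & G s} -> Prop :=
| word_equiv_one s : word_equiv [:: syllable (1%g : G s)] [::]
| word_equiv_mul s (g h : G s) :
    word_equiv [:: syllable g; syllable h] [:: syllable (g * h)%g]
| word_equiv_refl u : word_equiv u u
| word_equiv_sym u v : word_equiv u v -> word_equiv v u
| word_equiv_trans v u w : word_equiv u v -> word_equiv v w -> word_equiv u w
| word_equiv_cat u u' v v' :
    word_equiv u u' -> word_equiv v v' -> word_equiv (u ++ v) (u' ++ v').

Definition word_eqrel : equiv_rel (seq {s : S & G s}) :=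
  equiv_of_Prop word_equiv_refl word_equiv_sym word_equiv_trans.

Definition free_product : Type := {eq_quot word_eqrel}.

HB.instance Definition _ := Choice.on free_product.

Definition fp_class (u : seq {s : S & G s}) : free_product :=
  \pi_{eq_quot word_eqrel} u.

Lemma fp_classP u v : fp_class u = fp_class v <-> word_equiv u v.
Proof. by split => [/eqmodP/asboolP|/asboolP uv]; last exact/eqmodP. Qed.

Lemma fp_ind (P : free_product -> Prop) :
  (forall u, P (fp_class u)) -> forall a, P a.
Proof. by move=> Pu a; rewrite -[a]reprK; exact: Pu. Qed.

Let rep (a : free_product) : seq {s : S & G s} := repr (a : {eq_quot word_eqrel}).

Lemma fp_repK a : fp_class (rep a) = a. Proof. exact: reprK. Qed.

Definition syllable_inv (x : {s : S & G s}) : {s : S & G s} :=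
  syllable (tagged x)^-1%g.

Definition word_inv (u : seq {s : S & G s}) := rev (map syllable_inv u).

Lemma word_inv_cat u v : word_inv (u ++ v) = word_inv v ++ word_inv u.
Proof. by rewrite /word_inv map_cat rev_cat. Qed.

Lemma word_inv_equiv u v : word_equiv u v -> word_equiv (word_inv u) (word_inv v).
Proof.
elim=> {u v} [s|s g h|u|u v _|v u w _ uv _|u u' v v' _ uu _ vv].
- by rewrite /word_inv /= /rev /= /syllable_inv /= invg1; exact: word_equiv_one.
- by rewrite /word_inv /= /rev /= /syllable_inv /= invgM; exact: word_equiv_mul.
- exact: word_equiv_refl.
- exact: word_equiv_sym.
- exact: word_equiv_trans.
- by rewrite !word_inv_cat; exact: word_equiv_cat.
Qed.

Lemma word_invK : involutive word_inv.
Proof.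
move=> u; rewrite /word_inv map_rev revK -map_comp -[RHS]map_id.
by apply: eq_map => -[s g]; rewrite /= /syllable_inv /= invgK.
Qed.

Lemma word_mulV u : word_equiv (word_inv u ++ u) [::].
Proof.
elim: u => [|[s g] u IH]; first exact: word_equiv_refl.
rewrite -cat1s word_inv_cat -catA.
have xK : word_equiv (word_inv [:: Tagged G g] ++ [:: Tagged G g]) [::].
  apply: word_equiv_trans (word_equiv_one s).
  by rewrite -(mulVg g); exact: word_equiv_mul.
apply: word_equiv_trans IH.
apply: word_equiv_cat; first exact: word_equiv_refl.
rewrite catA -[X in word_equiv _ X]cat0s.
by apply: word_equiv_cat; [exact: xK|exact: word_equiv_refl].
Qed.

Definition fp_one : free_product := fp_class [::].
Definition fp_mul (a b : free_product) : free_product := fp_class (rep a ++ rep b).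
Definition fp_inv (a : free_product) : free_product := fp_class (word_inv (rep a)).

Lemma fp_mulE u v : fp_mul (fp_class u) (fp_class v) = fp_class (u ++ v).
Proof. by apply/fp_classP/word_equiv_cat; apply/fp_classP; exact: fp_repK. Qed.

Lemma fp_invE u : fp_inv (fp_class u) = fp_class (word_inv u).
Proof. by apply/fp_classP/word_inv_equiv; apply/fp_classP; exact: fp_repK. Qed.

Let fp_mulA : associative fp_mul.
Proof.
by elim/fp_ind => u; elim/fp_ind => v; elim/fp_ind => w; rewrite !fp_mulE catA.
Qed.

Let fp_mul1 : left_id fp_one fp_mul.
Proof. by elim/fp_ind => u; rewrite fp_mulE. Qed.

Let fp_mulr1 : right_id fp_one fp_mul.
Proof. by elim/fp_ind => u; rewrite fp_mulE cats0. Qed.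

Let fp_mulV : left_inverse fp_one fp_inv fp_mul.
Proof. by elim/fp_ind => u; rewrite fp_invE fp_mulE; apply/fp_classP/word_mulV. Qed.

Let fp_mulrV : right_inverse fp_one fp_inv fp_mul.
Proof.
elim/fp_ind => u; rewrite fp_invE fp_mulE; apply/fp_classP.
by rewrite -{1}[u]word_invK; exact: word_mulV.
Qed.

HB.instance Definition _ :=
  isGroup.Build free_product fp_mulA fp_mul1 fp_mulr1 fp_mulV fp_mulrV.

Definition fp_in (s : S) (g : G s) : free_product := fp_class [:: syllable g].

End FreeProduct.

Section QuotientByRelations.
Variables (G : groupType) (r : G -> G -> Prop).

(* [gen_congr a b] holds iff [a * b^-1] lies in the normal closure of the
   elements [c * d^-1] with [r c d]. *)
Inductive gen_congr : G -> G -> Prop :=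
| gen_congr_base a b : r a b -> gen_congr a b
| gen_congr_refl a : gen_congr a a
| gen_congr_sym a b : gen_congr a b -> gen_congr b a
| gen_congr_trans b a c : gen_congr a b -> gen_congr b c -> gen_congr a c
| gen_congr_mul a a' b b' :
    gen_congr a a' -> gen_congr b b' -> gen_congr (a * b)%g (a' * b')%g.

Lemma gen_congr_inv a b : gen_congr a b -> gen_congr a^-1%g b^-1%g.
Proof.
move=> ab; have := gen_congr_mul (gen_congr_refl a^-1%g)
  (gen_congr_mul ab (gen_congr_refl b^-1%g)).
by rewrite mulgV mulg1 mulKg => /gen_congr_sym.
Qed.

Definition gen_eqrel : equiv_rel G :=
  equiv_of_Prop gen_congr_refl gen_congr_sym gen_congr_trans.

Definition group_quot : Type := {eq_quot gen_eqrel}.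

HB.instance Definition _ := Choice.on group_quot.

Definition gq_class (a : G) : group_quot := \pi_{eq_quot gen_eqrel} a.

Lemma gq_classP a b : gq_class a = gq_class b <-> gen_congr a b.
Proof. by split => [/eqmodP/asboolP|/asboolP ab]; last exact/eqmodP. Qed.

Lemma gq_ind (P : group_quot -> Prop) :
  (forall a, P (gq_class a)) -> forall c, P c.
Proof. by move=> Pa c; rewrite -[c]reprK; exact: Pa. Qed.

Let rep (c : group_quot) : G := repr (c : {eq_quot gen_eqrel}).

Lemma gq_repK c : gq_class (rep c) = c. Proof. exact: reprK. Qed.

Definition gq_one : group_quot := gq_class 1%g.
Definition gq_mul (c d : group_quot) : group_quot := gq_class (rep c * rep d)%g.
Definition gq_inv (c : group_quot) : group_quot := gq_class (rep c)^-1%g.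

Lemma gq_mulE a b : gq_mul (gq_class a) (gq_class b) = gq_class (a * b)%g.
Proof. by apply/gq_classP/gen_congr_mul; apply/gq_classP; exact: gq_repK. Qed.

Lemma gq_invE a : gq_inv (gq_class a) = gq_class a^-1%g.
Proof. by apply/gq_classP/gen_congr_inv; apply/gq_classP; exact: gq_repK. Qed.

Let gq_mulA : associative gq_mul.
Proof.
by elim/gq_ind => a; elim/gq_ind => b; elim/gq_ind => c; rewrite !gq_mulE mulgA.
Qed.

Let gq_mul1 : left_id gq_one gq_mul.
Proof. by elim/gq_ind => a; rewrite gq_mulE mul1g. Qed.

Let gq_mulr1 : right_id gq_one gq_mul.
Proof. by elim/gq_ind => a; rewrite gq_mulE mulg1. Qed.

Let gq_mulV : left_inverse gq_one gq_inv gq_mul.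
Proof. by elim/gq_ind => a; rewrite gq_invE gq_mulE mulVg. Qed.

Let gq_mulrV : right_inverse gq_one gq_inv gq_mul.
Proof. by elim/gq_ind => a; rewrite gq_invE gq_mulE mulgV. Qed.

HB.instance Definition _ :=
  isGroup.Build group_quot gq_mulA gq_mul1 gq_mulr1 gq_mulV gq_mulrV.

End QuotientByRelations.

Section GraphProduct.
Variables (S : choiceType) (e : rel S) (G : S -> groupType).

Inductive graph_commutation : free_product G -> free_product G -> Prop :=
| GraphCommutation s t (g : G s) (h : G t) :
    e s t -> graph_commutation (fp_in g * fp_in h)%g (fp_in h * fp_in g)%g.

Definition graph_product : groupType := group_quot graph_commutation.

End GraphProduct.

Record simplicial_complex (n : nat) := SimplicialComplex {
  faces : {set {set 'I_n}};
  faces_sub : forall s t : {set 'I_n}, s \in faces -> t \subset s -> t \in faces;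
  faces0 : finset.set0 \in faces;
  faces1 : forall i, [set i]%SET \in faces
}.

Section Skeleton.
Variables (n : nat) (K : simplicial_complex n).

Section Faces.
Variable k : nat.

Definition skeleton_faces : {set {set 'I_n}} :=
  [set s in faces K | (#|s| <= k.+1)%N]%SET.

Lemma skeleton_faces_sub (s t : {set 'I_n}) :
  s \in skeleton_faces -> t \subset s -> t \in skeleton_faces.
Proof.
rewrite !inE => /andP[sK sk] ts; rewrite (faces_sub sK ts).
exact: leq_trans (subset_leq_card ts) sk.
Qed.

Lemma skeleton_faces0 : finset.set0 \in skeleton_faces.
Proof. by rewrite inE faces0 cards0. Qed.

Lemma skeleton_faces1 i : [set i]%SET \in skeleton_faces.
Proof. by rewrite inE faces1 cards1. Qed.

Definition skeleton : simplicial_complex n :=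
  SimplicialComplex skeleton_faces_sub skeleton_faces0 skeleton_faces1.

End Faces.

(* A simplicial graph has no loops: without [i != j] the graph product would
   abelianize the vertex groups. *)
Definition edge : rel 'I_n := [rel i j | (i != j) && ([set i; j]%SET \in faces K)].

End Skeleton.

Section PolyhedralProduct.
Variables (n : nat) (K : simplicial_complex n) (X : 'I_n -> topologicalType).

Definition polyhedral_product (A : forall i, set (X i)) : set (prod_topology X) :=
  \bigcup_(s in [set` faces K])
    [set x : prod_topology X | forall i, (if i \in s then setT else A i) (x i)].

Lemma polyhedral_product_base (A : forall i, set (X i)) (x : prod_topology X) :
  (forall i, A i (x i)) -> x \in polyhedral_product A.
Proof.
move=> Ax; rewrite inE; exists finset.set0; first exact: faces0.
by move=> i; rewrite inE.
Qed.

Variable pt : forall i, X i.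

(* The topology is induced by the product topology. *)
Definition ZK : topologicalType := polyhedral_product (fun i => [set pt i]).

Definition ZK_pt : ZK :=
  exist _ (pt : prod_topology X)
    (@polyhedral_product_base (fun i => [set pt i]) pt (fun i => erefl)).

End PolyhedralProduct.

Section CW.
Variable R : realType.

Definition disc k : set 'rV[R]_k := [set v | \sum_i v 0 i ^+ 2 <= 1].
Definition open_disc k : set 'rV[R]_k := [set v | \sum_i v 0 i ^+ 2 < 1].
Definition sphere k : set 'rV[R]_k := [set v | \sum_i v 0 i ^+ 2 = 1].

Arguments disc : clear implicits.
Arguments open_disc : clear implicits.
Arguments sphere : clear implicits.

(* Whitehead's definition (see Hatcher, Proposition A.2).  Only the values of
   [char_map c] on the closed disc matter.  Injectivity on the open disc is
   enough for it to be homeomorphic to the open cell: by compactness [char_map c]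
   is a closed map on the disc, and the image of the sphere, contained in cells
   of lower dimension, is disjoint from the open cell. *)
Record cw_structure (X : topologicalType) := CWStructure {
  cell : Type;
  dim : cell -> nat;
  char_map : forall c, 'rV[R]_(dim c) -> X;
  open_cell := fun c => @char_map c @` open_disc (dim c);
  cw_hausdorff : hausdorff_space X;
  char_map_cts : forall c, {within disc (dim c), continuous (@char_map c)};
  char_map_inj : forall c, set_inj (open_disc (dim c)) (@char_map c);
  open_cells_disjoint : trivIset setT open_cell;
  open_cells_cover : \bigcup_c open_cell c = setT;
  cell_boundary : forall c, exists2 F : set cell, finite_set F &
    (forall d, F d -> (dim d < dim c)%N) /\
    @char_map c @` sphere (dim c) `<=` \bigcup_(d in F) open_cell d;
  cw_weak_topology : forall A : set X,
    (forall c, closed (A `&` closure (open_cell c))) -> closed A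
}.

Definition subcomplex (X : topologicalType) (C : cw_structure X) (A : set X) : Prop :=
  exists2 D : set (cell C), A = \bigcup_(c in D) open_cell c &
    forall c, D c -> closure (open_cell c) `<=` A.

Definition cw_pair (X : topologicalType) (A : set X) : Prop :=
  exists C : cw_structure X, subcomplex C A.

End CW.

Section ClassifyingSpace.
Variable R : realType.
Local Notation I := (unit_interval R).

Definition contractible (E : topologicalType) : Prop :=
  exists x0 : E, exists H : E * I -> E,
    [/\ continuous H, forall x, H (x, zero) = x & forall x, H (x, one) = x0].

Record covering_action (G : groupType) (E : topologicalType) (act : G -> E -> E) : Prop := {
  act1 : forall x, act 1%g x = x;
  actM : forall g h x, act (g * h)%g x = act g (act h x);
  act_cts : forall g, continuous (act g);
  act_covering : forall x, exists U : set E, [/\ open U, U x &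
    forall g, g != 1%g -> U `&` (act g @` U) = set0]
}.

Record orbit_map (G : groupType) (E B : topologicalType) (act : G -> E -> E)
    (p : E -> B) : Prop := {
  orbit_map_surj : range p = setT;
  orbit_map_fibre : forall x y, p x = p y <-> exists g, y = act g x;
  orbit_map_open : forall U : set B, open U <-> open (p @^-1` U)
}.

(* BG is any CW-complex, with a 0-cell as base point, of the form EG / G where EG
   is contractible and G acts on it by a covering space action, i.e. EG -> BG is
   a principal bundle for the discrete group G. *)
Definition classifying_space (G : groupType) (B : topologicalType) (b : B) : Prop :=
  cw_pair R [set b] /\
  exists (E : topologicalType) (act : G -> E -> E) (p : E -> B),
    [/\ contractible E, covering_action act & orbit_map act p].

End ClassifyingSpace.

(* Main.v *)
Require Import Defs.
From HB Require Import structures.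
From mathcomp Require Import all_boot all_order all_algebra.
From mathcomp Require Import all_classical reals topology normedtype.
From mathcomp Require Import realfun continuous_path lra.

Set Implicit Arguments.
Unset Strict Implicit.
Unset Printing Implicit Defensive.

Import Order.TTheory GRing.Theory Num.Theory.
Import numFieldTopology.Exports numFieldNormedType.Exports.

Local Open Scope classical_set_scope.
Local Open Scope ring_scope.
Local Open Scope quotient_scope.

(** The two groups are compared by homomorphisms in opposite directions.

    From the fundamental group to the graph product.  A covering with group [G]
    is recorded on its base by a [transition] function: after a choice of a point
    [s z] in every fibre, [d z x], for [x] near [z], is the element that brings
    [s x] onto the sheet through [s z].  Any function satisfying the local cocycle
    identity, with values in any group, can be integrated along paths
    ([transport]); as it also has primitives on squares ([lift_exists_prod]), this
    is invariant under homotopy and gives the homomorphism [monodromy].  For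
    [EG -> BG] with [EG] contractible it is an isomorphism from the fundamental
    group of [BG] to [G] ([deck_monodromy_bij]).  On the polyhedral product, the
    product over all coordinates of these functions, taken in the graph product,
    is again a transition function ([ZK_transitionP]): the transition function of
    a coordinate is trivial near its base point, so that around a given point only
    the coordinates of one simplex contribute, and the corresponding vertex groups
    commute in the graph product.

    From the graph product to the fundamental group.  Coordinate loops belonging
    to the two ends of an edge commute, because they span a torus
    ([axis_pi1_commute]).  The universal property therefore yields a homomorphism
    of which the monodromy is a left inverse ([graph_product_to_pi1]).

    It remains to see that the coordinate loops generate ([loop_in_Im]).  Here the
    cell structures enter: at a badly behaved base point even the fundamental group
    of a wedge may be larger than the free product.  Because the base point is a
    vertex, some neighbourhood of it can be pushed into it by a homotopy of the
    whole space that fixes it ([cw_point_collapse]).  Done in all coordinates, this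
    deforms a loop into one that at any time stays for a while over a single
    simplex; such a loop decomposes into loops each over one simplex
    ([local_simplex_loop]), and these into coordinate loops ([simplex_loop]).

    The graph product depends only on the faces with at most two vertices
    ([edge_skeleton]), so a complex and its 1-skeleton give the same group. *)

(** * Homotopies inside a square *)

Lemma continuous_pairr (Y Z : topologicalType) (y : Y) :
  continuous (fun z : Z => (y, z)).
Proof. by move=> z; apply: cvg_pair; [exact: cvg_cst|exact: cvg_id]. Qed.

Lemma continuous_pairl (Y Z : topologicalType) (z : Z) :
  continuous (fun y : Y => (y, z)).
Proof. by move=> y; apply: cvg_pair; [exact: cvg_id|exact: cvg_cst]. Qed.

Section ConvexHomotopy.
Variables (R : realType) (X : topologicalType).
Local Notation I := (unit_interval R).

Lemma clamp_le0 (r : R) : r <= 0 -> clamp r = zero :> I.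
Proof.
move=> r0; apply: ival_inj; rewrite ival0 /ival /= /clamp01.
by rewrite min_l ?max_l //; lra.
Qed.

Lemma clamp_ge1 (r : R) : 1 <= r -> clamp r = one :> I.
Proof.
move=> r1; apply: ival_inj; rewrite ival1 /ival /= /clamp01.
by rewrite min_r ?max_r //; lra.
Qed.

Lemma continuous_pair (T Y Z : topologicalType) (f : T -> Y) (g : T -> Z) :
  continuous f -> continuous g -> continuous (fun t => (f t, g t)).
Proof. by move=> cf cg t; exact: (cvg_pair (cf t) (cg t)). Qed.

(** The square is convex: the two paths are the images of paths in it that are
    joined by the straight-line homotopy. *)
Lemma convex_homotopic (S : I * I -> X) (u1 u2 v1 v2 : I -> R) x y
    (p q : {path I from x to y}) :
  continuous S ->
  continuous u1 -> continuous u2 -> continuous v1 -> continuous v2 ->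
  p =1 (fun s => S (clamp (u1 s), clamp (u2 s))) ->
  q =1 (fun s => S (clamp (v1 s), clamp (v2 s))) ->
  u1 zero = v1 zero -> u2 zero = v2 zero -> u1 one = v1 one -> u2 one = v2 one ->
  path_homotopic p q.
Proof.
move=> cS cu1 cu2 cv1 cv2 pE qE e10 e20 e11 e21.
pose w (u v : I -> R) (z : I * I) := u z.1 + ival z.2 * (v z.1 - u z.1).
have cw u v : continuous u -> continuous v -> continuous (w u v).
  move=> cu cv.
  have c1 f : continuous f -> continuous (fun st : I * I => f st.1 : R).
    by move=> c st; apply: continuous_comp; [exact: cvg_fst|exact: c].
  move=> z; apply: cvgD; first exact: c1.
  apply: cvgM; last by apply: cvgB; exact: c1.
  by apply: continuous_comp; [exact: cvg_snd|exact: ival_continuous].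
exists (fun z => S (clamp (w u1 v1 z), clamp (w u2 v2 z))); split.
- move=> z; apply: (@continuous_comp _ _ _
    (fun z => (clamp (w u1 v1 z), clamp (w u2 v2 z)))); last exact: cS.
  by apply: continuous_pair; apply: clamp_comp_continuous; exact: cw.
- by move=> s; rewrite pE /w /= ival0 !mul0r !addr0.
- by move=> s; rewrite qE /w /= ival1 !mul1r ![_ + (_ - _)]addrC !subrK.
- by move=> t; rewrite /w /= e10 e20 !subrr !mulr0 !addr0 -qE; exact: path_zero.
- by move=> t; rewrite /w /= e11 e21 !subrr !mulr0 !addr0 -qE; exact: path_one.
Qed.

Lemma affine_continuous (T : topologicalType) (h : T -> R) (a b : R) :
  continuous h -> continuous (fun t => a * h t + b).
Proof.
by move=> ch t; apply: cvgD; [apply: cvgM; [exact: cvg_cst|exact: ch]|exact: cvg_cst].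
Qed.

Let affine_ival_continuous (a b : R) : continuous (fun s : I => a * ival s + b).
Proof. exact/affine_continuous/ival_continuous. Qed.

(** The path that runs along the bottom edge and then up the right edge of the
    square has the coordinates [fst_half] and [snd_half]. *)
Definition fst_half (s : I) : R := Num.min (2 * ival s + 0) 1.
Definition snd_half (s : I) : R := Num.max (2 * ival s + -1) 0.

Lemma fst_half_continuous : continuous fst_half.
Proof.
by move=> s; apply: (@continuous_min R I (fun s => 2 * ival s + 0) (fun=> 1));
  [exact: affine_ival_continuous|exact: (@cst_continuous I R 1 s)].
Qed.

Lemma snd_half_continuous : continuous snd_half.
Proof.
by move=> s; apply: (@continuous_max R I (fun s => 2 * ival s + -1) (fun=> 0));
  [exact: affine_ival_continuous|exact: (@cst_continuous I R 0 s)].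
Qed.

Lemma fst_half0 : fst_half zero = 0.
Proof. by rewrite /fst_half ival0 min_l; lra. Qed.
Lemma fst_half1 : fst_half one = 1.
Proof. by rewrite /fst_half ival1 min_r; lra. Qed.
Lemma snd_half0 : snd_half zero = 0.
Proof. by rewrite /snd_half ival0 max_r; lra. Qed.
Lemma snd_half1 : snd_half one = 1.
Proof. by rewrite /snd_half ival1 max_l; lra. Qed.

Lemma concat_edges (S : I * I -> X) x y z (p : {path I from x to y})
    (r : {path I from y to z}) :
  p =1 (fun s => S (s, zero)) -> r =1 (fun t => S (one, t)) ->
  concat p r =1 (fun s => S (clamp (fst_half s), clamp (snd_half s))).
Proof.
move=> pE rE s; rewrite -[LHS]/(concat_fun p r s) /concat_fun /fst_half /snd_half.
case: ifPn => h.
  by rewrite pE min_l ?max_r ?addr0; [rewrite [X in S (_, X)]clamp_le0|lra..].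
rewrite rE; move: h; rewrite -ltNge => h.
by rewrite min_r ?max_l ?[X in S (X, _)]clamp_ge1 //; lra.
Qed.

Lemma square_homotopic (S : I * I -> X) x y z w
    (p : {path I from x to y}) (r : {path I from y to z})
    (l : {path I from x to w}) (c : {path I from w to z}) :
  continuous S ->
  p =1 (fun s => S (s, zero)) -> r =1 (fun t => S (one, t)) ->
  l =1 (fun t => S (zero, t)) -> c =1 (fun s => S (s, one)) ->
  path_homotopic (concat p r) (concat l c).
Proof.
move=> cS pE rE lE cE.
have E2 := @concat_edges (S \o (fun z => (z.2, z.1))) _ _ _ _ _ lE cE.
have [c1 c2] := (fst_half_continuous, snd_half_continuous).
by apply: (convex_homotopic cS c1 c2 c2 c1 (concat_edges pE rE) E2);
  rewrite ?fst_half0 ?fst_half1 ?snd_half0 ?snd_half1.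
Qed.

Lemma diagonal_homotopic (S : I * I -> X) x y z
    (p : {path I from x to y}) (r : {path I from y to z})
    (d : {path I from x to z}) :
  continuous S ->
  p =1 (fun s => S (s, zero)) -> r =1 (fun t => S (one, t)) ->
  d =1 (fun s => S (s, s)) ->
  path_homotopic d (concat p r).
Proof.
move=> cS pE rE dE.
have [c1 c2] := (fst_half_continuous, snd_half_continuous).
have ci := @ival_continuous R.
have D : d =1 (fun s => S (clamp (ival s), clamp (ival s))).
  by move=> s; rewrite dE ivalK.
by apply: (convex_homotopic cS ci ci c1 c2 D (concat_edges pE rE));
  rewrite ?fst_half0 ?fst_half1 ?snd_half0 ?snd_half1 ?ival0 ?ival1.
Qed.

End ConvexHomotopy.

(** * Transition functions and their lifts *)

Lemma connected_locally_constant (T : topologicalType) (A P : set T) :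
  connected A ->
  (forall t, A t -> \forall u \near t, A u -> (P u <-> P t)) ->
  forall t u, A t -> A u -> P t -> P u.
Proof.
move=> cA lP t u At Au Pt.
suff AP : A `&` P = A by move: Au; rewrite -AP => -[].
apply: cA; first by exists t.
- exists ((fun v => A v -> P v)^°); first exact: open_interior.
  apply/seteqP; split => v [Av].
    by move=> Pv; split => //; have := lP v Av; apply: filterS => w H Aw; apply/H.
  by move=> Pv; split => //; exact: (interior_subset Pv).
- exists (~` (fun v => A v -> ~ P v)^°).
    exact/open_closedC/open_interior.
  apply/seteqP; split => v [Av] Pv; split => //.
    by move=> nP; exact: (interior_subset nP).
  apply: contrapT => nP; apply: Pv.
  by have := lP v Av; apply: filterS => w H Aw /(H Aw).
Qed.

Section UnitIntervalTopology.
Variable R : realType.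
Local Notation I := (unit_interval R).

(** The balls for the distance of the real line form a basis of connected
    neighbourhoods; they replace a metric on the interval. *)
Lemma near_unit_interval (t : I) (U : set I) :
  (\forall u \near t, U u) ->
  exists2 e : R, 0 < e & forall u, `|ival t - ival u| < e -> U u.
Proof.
move=> tU.
have : \forall r \near ival t, U (clamp r).
  by apply: (@clamp_continuous R (ival t)); rewrite ivalK.
move=> /nbhs_ballP[e e0 eU]; exists e => // u tu.
by rewrite -(ivalK u); apply: eU.
Qed.

Lemma unit_interval_near (t : I) (e : R) : 0 < e ->
  \forall u \near t, `|ival t - ival u| < e.
Proof.
move=> e0; apply: (@ival_continuous R t [set r | `|ival t - r| < e]).
by apply/nbhs_ballP; exists e.
Qed.

Lemma unit_interval_connected_ball (t : I) (e : R) :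
  connected [set u : I | `|ival t - ival u| < e].
Proof.
set J := [set u | _].
have -> : J = @clamp R @` (`]ival t - e, ival t + e[ `&` `[0, 1]).
  apply/seteqP; split => [u|_ [r [/= rt r01]] <-]; rewrite /J /=.
    move=> tu; exists (ival u); last exact: ivalK.
    rewrite /= !in_itv /= ival_ge0 ival_le1; split => //.
    by move: tu; rewrite ltr_norml; lra.
  move: rt r01; rewrite !in_itv /= => rt r01.
  by rewrite clampK // ltr_norml; lra.
apply: connected_continuous_connected.
  apply/connected_intervalP => x y /= [xt x01] [yt y01] z.
  move: xt x01 yt y01; rewrite !in_itv /= => xt x01 yt y01 zxy.
  by split; lra.
by apply: continuous_subspaceT; exact: clamp_continuous.
Qed.

Lemma unit_interval_connected : connected [set: I].
Proof.
have -> : [set: I] = [set u | `|ival (zero : I) - ival u| < 2].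
  apply/seteqP; split => // u _ /=; rewrite ival0 ltr_norml.
  by have := ival_ge0 u; have := ival_le1 u; lra.
exact: unit_interval_connected_ball.
Qed.

End UnitIntervalTopology.

Section Lifts.
Variable Gm : groupType.

(** Covering data read on the base: [d z x] is meaningful only for [x] near [z],
    and the cocycle identity is required only for points that are close in this
    iterated sense.  It may be discontinuous, since it depends on an arbitrary
    choice of one point in every fibre. *)
Definition transition (X : topologicalType) (d : X -> X -> Gm) : Prop :=
  forall z, \forall w \near z, \forall x \near w, d z x = (d z w * d w x)%g.

(** A primitive of [d]; for the transition function of a covering, the coordinate
    in the fibre of a continuous section over [Q]. *)
Definition is_lift (Q : topologicalType) (d : Q -> Q -> Gm) (g : Q -> Gm) : Prop :=
  forall q, \forall r \near q, g r = (g q * d q r)%g.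

Lemma transition_diag (X : topologicalType) (d : X -> X -> Gm) x :
  transition d -> d x x = 1%g.
Proof.
move=> td; have /nbhs_singleton/nbhs_singleton E := td x.
by apply: (@mulgI _ (d x x)); rewrite -E mulg1.
Qed.

Lemma transition_comp (Q X : topologicalType) (f : Q -> X) (d : X -> X -> Gm) :
  continuous f -> transition d -> transition (fun q r => d (f q) (f r)).
Proof.
move=> cf td q.
pose D w := [set x | d (f q) x = (d (f q) w * d w x)%g].
have cfD : \forall r \near q, \forall x \near f r, D (f r) x := cf q _ (td (f q)).
near=> r; have /(_ (D (f r))) := cf r; apply; near: r; exact: cfD.
Unshelve. all: by end_near.
Qed.

Lemma is_lift_comp (P Q : topologicalType) (f : P -> Q) (d : Q -> Q -> Gm) g :
  continuous f -> is_lift d g ->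
  is_lift (fun q r => d (f q) (f r)) (g \o f).
Proof. by move=> cf lg q; exact: cf q _ (lg (f q)). Qed.

Lemma is_liftMl (Q : topologicalType) (d : Q -> Q -> Gm) g a :
  is_lift d g -> is_lift d (fun q => a * g q)%g.
Proof. by move=> lg q; have := lg q; apply: filterS => r ->; rewrite mulgA. Qed.

(** The quotient of two primitives is locally constant. *)
Lemma is_lift_unique (Q : topologicalType) (d : Q -> Q -> Gm) (A : set Q) g h :
  connected A ->
  (forall q, A q -> \forall r \near q, A r -> g r = (g q * d q r)%g) ->
  (forall q, A q -> \forall r \near q, A r -> h r = (h q * d q r)%g) ->
  forall q r, A q -> A r -> (g q * (h q)^-1 = g r * (h r)^-1)%g.
Proof.
move=> cA lg lh q r Aq Ar.
apply: (connected_locally_constant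
  (P := fun r => (g q * (h q)^-1 = g r * (h r)^-1)%g) cA _ Aq Ar erefl) => s As.
near=> t => At.
have -> : g t = (g s * d s t)%g by move: At; near: t; exact: lg.
have -> : h t = (h s * d s t)%g by move: At; near: t; exact: lh.
by rewrite invgM mulgA mulgK.
Unshelve. all: by end_near. Qed.

Section UnitIntervalLift.
Variable R : realType.
Local Notation I := (unit_interval R).

(** Locally, [d t] is a primitive.  Primitives on initial segments are prolonged by
    gluing, and the end points up to which one exists form a set that is locally
    constant, hence everything. *)
Lemma lift_exists_interval (d : I -> I -> Gm) : transition d -> exists g, is_lift d g.
Proof.
move=> td.
pose P (t : I) := exists g : I -> Gm, forall q, ival q <= ival t ->
  \forall r \near q, ival r <= ival t -> g r = (g q * d q r)%g.
suff [g lg] : P one.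
  exists g => q; have := lg q; rewrite ival1 ival_le1 => /(_ isT).
  by apply: filterS => r; apply; exact: ival_le1.
have P0 : P zero.
  exists (fun=> 1%g) => q; rewrite ival0 => q0.
  have eq0 (r : I) : ival r <= 0 -> r = zero.
    move=> r0; apply: ival_inj; rewrite ival0.
    by apply/eqP; rewrite eq_le r0 ival_ge0.
  by rewrite (eq0 _ q0); near=> r => /eq0 ->; rewrite mul1g transition_diag.
have ltP (a b : I) : ival a < ival b -> \forall u \near a, ival u < ival b.
  move=> ab; near=> u.
  have : `|ival a - ival u| < ival b - ival a.
    by near: u; apply: unit_interval_near; lra.
  by rewrite ltr_norml; lra.
have gtP (a b : I) : ival a < ival b -> \forall u \near b, ival a < ival u.
  move=> ab; near=> u.
  have : `|ival b - ival u| < ival b - ival a.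
    by near: u; apply: unit_interval_near; lra.
  by rewrite ltr_norml; lra.
apply: (connected_locally_constant (@unit_interval_connected R) _ _ _ P0) => // t _.
have [e e0 eJ] := near_unit_interval (td t).
suff H t1 t2 : `|ival t - ival t1| < e -> `|ival t - ival t2| < e -> P t1 -> P t2.
  near=> u => _.
  have tu : `|ival t - ival u| < e by near: u; exact: unit_interval_near.
  by split; apply: H; rewrite ?subrr ?normr0.
move=> t1e t2e [g lg]; have [t21|t12] := leP (ival t2) (ival t1).
  exists g => q qt; have := lg q (le_trans qt t21).
  by apply: filterS => r H rt; apply: H; exact: le_trans rt t21.
(* Beyond [t1] the local primitive [d t] takes over, rescaled to agree at [t1]. *)
pose g' r := if ival r <= ival t1 then g r else (g t1 * (d t t1)^-1 * d t r)%g.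
exists g' => q qt; have := eJ q.
case: (ltgtP (ival q) (ival t1)) => [qt1 _|qt1|/ival_inj qt1].
- near=> r => _.
  have rt1 : ival r < ival t1 by near: r; exact: ltP.
  rewrite /g' !ltW //; move: (ltW rt1); near: r; exact/lg/ltW.
- have qte : `|ival t - ival q| < e.
    by move: t1e t2e; rewrite !ltr_norml; lra.
  move=> /(_ qte) H.
  near=> r => _.
  have rt1 : ival t1 < ival r by near: r; exact: gtP.
  rewrite /g' !leNgt qt1 rt1 /= -[RHS]mulgA; congr (_ * _)%g.
  by near: r.
- rewrite qt1 => /(_ t1e) H.
  near=> r => _; rewrite /g' lexx.
  case: ifPn => rt; first by move: rt; near: r; exact: lg.
  rewrite -mulgA; congr (_ * _)%g.
  by apply/(canLR (mulKg _)); near: r.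
Unshelve. all: by end_near. Qed.

End UnitIntervalLift.

(** Primitives along the vertical lines, normalized by a primitive along one
    horizontal line, fit together: the heights at which they form a primitive in
    both variables contain [z0] and form a locally constant set. *)
Lemma lift_exists_prod (Y Z : topologicalType) (z0 : Z) (d : Y * Z -> Y * Z -> Gm) :
  connected [set: Z] ->
  (forall (z : Z) U, nbhs z U -> exists2 J, nbhs z J & J `<=` U /\ connected J) ->
  transition d ->
  (forall y, exists g, is_lift (fun z z' => d (y, z) (y, z')) g) ->
  (exists g, is_lift (fun y y' => d (y, z0) (y', z0)) g) ->
  exists g, is_lift d g.
Proof.
move=> cZ lcZ td /choice[v lv] [a la].
pose g (q : Y * Z) := (a q.1 * ((v q.1 z0)^-1 * v q.1 q.2))%g.
have lg y : is_lift (fun z z' => d (y, z) (y, z')) (fun z => g (y, z)).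
  by move=> q; have := lv y q; apply: filterS => r; rewrite /g /= => ->; rewrite !mulgA.
have ga y : g (y, z0) = a y by rewrite /g /= mulVg mulg1.
exists g => -[y0 z].
pose C := [set z | \forall q \near (y0, z), g q = (g (y0, z) * d (y0, z) q)%g].
(* On a box around [(y0, z1)] the quotient of [g] by the local primitive
   [d (y0, z1)] is constant along vertical segments, so that it suffices to know
   that it is constant in the other direction at a single height [z2]. *)
have key z1 : exists2 J : set Z, nbhs z1 J &
    (forall z2, J z2 -> \forall x \near (y0, z2),
      d (y0, z1) x = (d (y0, z1) (y0, z2) * d (y0, z2) x)%g) /\
    forall z2 z3, J z2 -> J z3 ->
    (\forall y \near y0, g (y, z2) * (d (y0, z1) (y, z2))^-1 =
       g (y0, z2) * (d (y0, z1) (y0, z2))^-1)%g ->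
    nbhs z3 J -> C z3.
  pose N := [set w | \forall x \near w, d (y0, z1) x = (d (y0, z1) w * d w x)%g].
  have [[Y1 Z1] /= [nY1 nZ1] YZN] : nbhs (y0, z1) N := td (y0, z1).
  have [J nJ [JZ1 cJ]] := lcZ _ _ nZ1.
  exists J => //; split=> [z2 J2|z2 z3 J2 J3 k2 nJ3].
    by apply: (YZN (y0, z2)); split; [exact: nbhs_singleton|exact: JZ1].
  have kJ y z4 z5 : Y1 y -> J z4 -> J z5 ->
      (g (y, z4) * (d (y0, z1) (y, z4))^-1 =
       g (y, z5) * (d (y0, z1) (y, z5))^-1)%g.
    move=> Yy J4 J5.
    apply: (is_lift_unique (d := fun z z' => d (y, z) (y, z'))
      (g := fun z => g (y, z)) (h := fun z => d (y0, z1) (y, z)) cJ) => //.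
      by move=> q Jq; have := lg y q; apply: filterS => r ->.
    move=> q Jq; have : N (y, q) by apply: YZN; split => //; exact: JZ1.
    move=> Nq; near=> r => _; near: r; exact: (@continuous_pairr Y Z y q _ Nq).
  have N3 : N (y0, z3).
    by apply: YZN; split; [exact: nbhs_singleton|exact: JZ1].
  rewrite /C /=; near=> q.
  have -> : d (y0, z3) q = ((d (y0, z1) (y0, z3))^-1 * d (y0, z1) q)%g.
    by apply/esym/(canLR (mulKg _)); near: q.
  rewrite mulgA (kJ y0 z3 z2) //; last exact: nbhs_singleton.
  have [qY qJ] : Y1 q.1 /\ J q.2.
    near: q; exists (Y1, J) => //.
  have <- : (g (q.1, z2) * (d (y0, z1) (q.1, z2))^-1 =
       g (y0, z2) * (d (y0, z1) (y0, z2))^-1)%g.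
    near: q; exact: (@cvg_fst _ _ (nbhs y0) (nbhs z3) _ _ k2).
  by rewrite (kJ q.1 z2 q.2) // -surjective_pairing mulgVK.
suff : C z by [].
have Cz0 : C z0.
  have [J nJ [_ H]] := key z0.
  have Jz0 := nbhs_singleton nJ.
  apply: (H z0) => //.
  near=> y; rewrite !ga (transition_diag _ td) invg1 mulg1; apply/(canLR (mulgK _)).
  by near: y; exact: la.
apply: (connected_locally_constant cZ _ _ _ Cz0) => // z1 _.
have [J nJ [dJ H]] := key z1.
have CJ z2 z3 : nbhs z2 J -> nbhs z3 J -> C z2 -> C z3.
  move=> nJ2 nJ3 C2; have J2 := nbhs_singleton nJ2.
  apply: (H z2) => //; first exact: nbhs_singleton.
  near=> y.
  have -> : g (y, z2) = (g (y0, z2) * d (y0, z2) (y, z2))%g.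
    by near: y; exact: @continuous_pairl Y Z z2 y0 _ C2.
  have -> : d (y0, z1) (y, z2) = (d (y0, z1) (y0, z2) * d (y0, z2) (y, z2))%g.
    by near: y; exact: @continuous_pairl Y Z z2 y0 _ (dJ z2 J2).
  by rewrite invgM mulgA mulgK.
near=> u => _; have nJu : nbhs u J by near: u; exact: nbhs_interior.
by split; apply: CJ.
Unshelve. all: by end_near. Qed.

End Lifts.

Section Transport.
Variables (R : realType) (X : topologicalType) (Gm : groupType) (d : X -> X -> Gm).
Hypothesis td : transition d.
Local Notation I := (unit_interval R).

Definition along (Q : Type) (f : Q -> X) (q r : Q) : Gm := d (f q) (f r).

Definition transport (f : I -> X) : Gm :=
  xget 1%g [set a | exists2 g, is_lift (along f) g & a = ((g zero)^-1 * g one)%g].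

Lemma lift_of_path (f : I -> X) : continuous f -> exists g, is_lift (along f) g.
Proof. by move=> cf; apply: lift_exists_interval; exact: transition_comp. Qed.

Lemma is_lift_endpoints (e : I -> I -> Gm) g h : is_lift e g -> is_lift e h ->
  (g zero * (h zero)^-1 = g one * (h one)^-1)%g.
Proof.
move=> lg lh; apply: (is_lift_unique (d := e) (@unit_interval_connected R)) => // q _.
  by have := lg q; apply: filterS => r ->.
by have := lh q; apply: filterS => r ->.
Qed.

Lemma transportE (f : I -> X) g : is_lift (along f) g ->
  transport f = ((g zero)^-1 * g one)%g.
Proof.
move=> lg; apply: xget_unique; first by exists g.
move=> _ [h lh ->]; have E := is_lift_endpoints lh lg.
by rewrite -(mulgVK (g one) (h one)) -E -mulgA mulKg.
Qed.

Lemma is_lift_cst x (Q : topologicalType) : is_lift (along (fun _ : Q => x)) (fun=> 1%g).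
Proof. by move=> q; apply: nearW => r; rewrite /along transition_diag // mulg1. Qed.

(** A primitive over the whole homotopy is constant along the two sides on which
    the homotopy is constant. *)
Lemma transport_homotopic x y (p q : {path I from x to y}) :
  path_homotopic p q -> transport p = transport q.
Proof.
move=> [H [cH H0 H1 Hx Hy]].
have cl (s : I) : continuous (fun t : I => (s, t)) by exact: continuous_pairr.
have cr (t : I) : continuous (fun s : I => (s, t)) by exact: continuous_pairl.
have [g lg] : exists g, is_lift (along H) g.
  apply: (@lift_exists_prod _ _ _ zero).
  - exact: unit_interval_connected.
  - move=> t U /near_unit_interval[e e0 eU].
    exists [set u : I | `|ival t - ival u| < e]; first exact: unit_interval_near.
    by split => //; exact: unit_interval_connected_ball.
  - exact: transition_comp.
  - move=> s; apply: lift_of_path.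
    by move=> t; apply: continuous_comp; [exact: cl|exact: cH].
  - apply: (@lift_of_path (fun s => H (s, zero))).
    by move=> s; apply: (@continuous_comp _ _ _ (fun s => (s, zero))); [exact: cr|exact: cH].
have side s z : (forall t, H (s, t) = z) -> g (s, zero) = g (s, one).
  move=> Hz; have L : is_lift (along (fun _ : I => z)) (fun t => g (s, t)).
    have -> : (fun=> z) = (fun t => H (s, t)) by apply/funext => t; rewrite Hz.
    exact: is_lift_comp (cl s) lg.
  have := is_lift_endpoints L (@is_lift_cst z _).
  by rewrite invg1 !mulg1.
have -> : (p : I -> X) = fun s => H (s, zero) by apply/funext => s; rewrite H0.
have -> : (q : I -> X) = fun s => H (s, one) by apply/funext => s; rewrite H1.
rewrite (transportE (is_lift_comp (cr zero) lg)).
rewrite (transportE (is_lift_comp (cr one) lg)) /=.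
by rewrite (side zero x Hx) (side one y Hy).
Qed.

Lemma transport_concat x y z (p : {path I from x to y}) (q : {path I from y to z}) :
  transport (concat p q) = (transport p * transport q)%g.
Proof.
have [g lg] := lift_of_path (@cts_fun _ _ (concat p q)).
pose u (s : I) : I := clamp (2^-1 * ival s + 0).
pose v (s : I) : I := clamp (2^-1 * ival s + 2^-1).
have cu : continuous u by exact/clamp_comp_continuous/affine_continuous/ival_continuous.
have cv : continuous v by exact/clamp_comp_continuous/affine_continuous/ival_continuous.
have pE : (p : I -> X) = concat p q \o u.
  apply/funext => s; have := ival_ge0 s; have := ival_le1 s => s1 s0.
  rewrite -[RHS]/(concat_fun p q (u s)) concat_clampL; [|lra..].
  by rewrite -[LHS](congr1 p (ivalK s)); congr (p (clamp _)); lra.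
have qE : (q : I -> X) = concat p q \o v.
  apply/funext => s; have := ival_ge0 s; have := ival_le1 s => s1 s0.
  rewrite -[RHS]/(concat_fun p q (v s)).
  have [s00|sp] := leP (ival s) 0.
    have -> : s = zero by apply: ival_inj; rewrite ival0; lra.
    rewrite /v ival0 concat_clampL; [|lra..].
    rewrite (_ : clamp _ = one) ?path_one ?path_zero //.
    by apply: clamp_ge1; lra.
  rewrite concat_clampR; [|lra..].
  by rewrite -[LHS](congr1 q (ivalK s)); congr (q (clamp _)); lra.
rewrite (transportE lg) pE qE (transportE (is_lift_comp cu lg)).
rewrite (transportE (is_lift_comp cv lg)) /=.
have -> : u zero = zero by rewrite /u ival0 clamp_le0 //; lra.
have -> : v one = one by rewrite /v ival1 clamp_ge1 //; lra.
have -> : u one = v zero by rewrite /u /v ival0 ival1; congr clamp; lra.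
by rewrite -mulgA mulVKg.
Qed.

Variable x : X.

Definition monodromy (a : pi1 R x) : Gm :=
  transport (repr (a : {eq_quot loop_equiv R x})).

Lemma monodromyE (p : {path I from x to x}) : monodromy (pi1_class p) = transport p.
Proof. by apply/transport_homotopic/pi1_classP; exact: pi1_repK. Qed.

Lemma pi1_classM (p q : {path I from x to x}) :
  (pi1_class p * pi1_class q)%g = pi1_class (concat p q).
Proof. exact: pi1_mulE. Qed.

Lemma monodromyM : {morph monodromy : a b / (a * b)%g}.
Proof.
elim/pi1_ind => p; elim/pi1_ind => q.
by rewrite pi1_classM !monodromyE transport_concat.
Qed.

End Transport.

Arguments monodromy {R X Gm} d {x} a.

(** * Quotients of contractible spaces by covering actions *)

Section Contractible.
Variables (R : realType) (E : topologicalType).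
Local Notation I := (unit_interval R).
Hypothesis cE : contractible R E.

(** A contraction [H] need not fix any point, so a path [r] from [a] to [b] is
    compared with the tracks of its ends: the square [H (r s, t)] identifies [r]
    followed by the track of [b] with the track of [a]. *)
Lemma contractible_homotopic (a b : E) (p q : {path I from a to b}) : path_homotopic p q.
Proof.
have [x0 [H [cH H0 H1]]] := cE.
have cHa a' : continuous (fun t : I => H (a', t)).
  by move=> t; apply: (@continuous_comp _ _ _ (fun t => (a', t)));
    [exact: continuous_pairr|exact: cH].
pose c a' : {path I from a' to x0} := mk_path (cHa a') (H0 a') (H1 a').
have key (r : {path I from a to b}) :
    path_homotopic (concat r (c b)) (concat (c a) (cst_loop R x0)).
  apply: (@square_homotopic _ _ (fun st => H (r st.1, st.2))).
  - move=> st; apply: (@continuous_comp _ _ _ (fun st : I * I => (r st.1, st.2))).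
      apply: continuous_pair => z; last exact: cvg_snd.
      by apply: (@continuous_comp _ _ _ fst r); [exact: cvg_fst|exact: cts_fun].
    exact: cH.
  - by move=> s; rewrite /= H0.
  - by move=> s; rewrite /= path_one.
  - by move=> s; rewrite /= path_zero.
  - by move=> s; rewrite /= H1.
have {}key : path_homotopic (concat p (c b)) (concat q (c b)).
  exact: path_homotopic_trans (key p) (path_homotopic_sym (key q)).
have cancel (r : {path I from a to b}) :
    path_homotopic (concat (concat r (c b)) (Defs.rev_path (c b))) r.
  apply: path_homotopic_trans (path_homotopic_sym (concatA _ _ _)) _.
  apply: path_homotopic_trans (concatp1 r).
  exact: concat_homotopic (path_homotopic_refl _) (concatpV _).
apply: path_homotopic_trans (path_homotopic_sym (cancel p)) _.
apply: path_homotopic_trans (cancel q).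
exact: concat_homotopic key (path_homotopic_refl _).
Qed.

Lemma contractible_path (a b : E) : exists p : {path I from a to b}, True.
Proof.
have [x0 [H [cH H0 H1]]] := cE.
have cHa a' : continuous (fun t : I => H (a', t)).
  by move=> t; apply: (@continuous_comp _ _ _ (fun t => (a', t)));
    [exact: continuous_pairr|exact: cH].
pose c a' : {path I from a' to x0} := mk_path (cHa a') (H0 a') (H1 a').
by exists (concat (c a) (Defs.rev_path (c b))).
Qed.

End Contractible.

Section Covering.
Variables (R : realType) (G : groupType) (E B : topologicalType).
Variables (act : G -> E -> E) (p : E -> B) (b0 : B).
Hypotheses (cact : covering_action act) (omap : orbit_map act p).
Local Notation I := (unit_interval R).

Definition is_sheet (U : set E) : Prop :=
  open U /\ forall g, g != 1%g -> U `&` (act g @` U) = set0.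

(** The points of an orbit are distinguished by group elements as soon as they meet
    a common sheet. *)
Lemma sheet_unique U e g h : is_sheet U -> U (act g e) -> U (act h e) -> g = h.
Proof.
move=> [_ dU] Ug Uh; apply/esym/eqP; rewrite -divg_eq1; apply/negP => /negP /dU.
apply/eqP/set0P; exists (act h e); split => //; exists (act g e) => //.
by rewrite -(actM cact) mulgVK.
Qed.

Lemma orbit_map_act g e : p (act g e) = p e.
Proof. by apply/esym/(orbit_map_fibre omap); exists g. Qed.

Lemma orbit_map_image_open U : open U -> open (p @` U).
Proof.
move=> oU; apply/(orbit_map_open omap).
have -> : p @^-1` (p @` U) = \bigcup_g (act g @^-1` U).
  apply/seteqP; split => [e [u Uu /esym/(orbit_map_fibre omap)[g gE]]|e [g _ Ug]].
    by exists g => //=; rewrite -gE.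
  by exists (act g e) => //; exact: orbit_map_act.
apply: bigcup_open => g _; apply: open_comp => // e _.
exact: (act_cts cact).
Qed.

Lemma sheets_exist : exists U : E -> set E, forall e, is_sheet (U e) /\ U e e.
Proof.
have /choice[U UP] : forall e, exists U, is_sheet U /\ U e.
  by move=> e; have [U [oU Ue dU]] := act_covering cact e; exists U.
by exists U.
Qed.

Variables (U : E -> set E) (e0 : E).
Hypotheses (sU : forall e, is_sheet (U e)) (Uid : forall e, U e e) (pe0 : p e0 = b0).

(* Over the sheet of [e0] the section takes values in that sheet, so that paths
   near the base point are not seen by the transition function. *)
Lemma section_exists : exists s : B -> E,
  (forall b, p (s b) = b) /\ forall e, U e0 e -> s (p e) = e.
Proof.
have /choice[s sP] : forall b, exists e, p e = b /\ forall u, U e0 u -> p u = b -> u = e.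
  move=> b; have [[u [Uu pu]]|nU] := pselect (exists u, U e0 u /\ p u = b).
    exists u; split => // v Uv pv.
    have [g gE] : exists g, u = act g v by apply/(orbit_map_fibre omap); rewrite pv pu.
    have U1 : U e0 (act 1%g v) by rewrite (act1 cact).
    have Ug : U e0 (act g v) by rewrite -gE.
    by rewrite gE -(sheet_unique (sU e0) U1 Ug) (act1 cact).
  have [e _ pe] : range p b by rewrite (orbit_map_surj omap).
  by exists e; split => // u Uu pu; case: nU; exists u.
exists s; split => [b|e Ue]; first by have [] := sP b.
by have [_ /(_ e Ue erefl)] := sP (p e).
Qed.

Variable s : B -> E.
Hypotheses (ps : forall b, p (s b) = b) (s0 : forall e, U e0 e -> s (p e) = e).

(** Only for [x] in the image of the sheet [U (s z)] is there such a [g]. *)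
Definition deck (z x : B) : G := xget 1%g [set g | U (s z) (act g (s x))].

Lemma deckE z x g : U (s z) (act g (s x)) -> deck z x = g.
Proof.
by move=> Ug; apply: xget_unique => // h Uh; exact: sheet_unique Uh Ug.
Qed.

Lemma near_sheet z V : open V -> V (s z) ->
  \forall x \near z, exists2 g, V (act g (s x)) & True.
Proof.
move=> oV Vz; have : nbhs z (p @` V).
  by apply: open_nbhs_nbhs; split; [exact: orbit_map_image_open|exists (s z)].
apply: filterS => x [v Vv pv].
have [g gE] : exists g, v = act g (s x) by apply/(orbit_map_fibre omap); rewrite ps.
by exists g => //; rewrite -gE.
Qed.

(** The element for a composite displacement multiplies because the sheet at [s w],
    translated by [deck z w], overlaps the sheet at [s z]. *)
Lemma deck_transition : transition deck.
Proof.
move=> z; have := near_sheet (sU _).1 (Uid (s z)); apply: filterS => w [g Ug _].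
have oV : open (U (s w) `&` act g @^-1` U (s z)).
  apply: openI; first exact: (sU _).1.
  by apply: open_comp; [move=> e _; exact: (act_cts cact)|exact: (sU _).1].
have := near_sheet oV (conj (Uid _) Ug); apply: filterS => x [h [Uh Ugh] _].
by rewrite (deckE Ug) (deckE Uh) (@deckE _ _ (g * h)%g) // (actM cact).
Qed.

(** Around the base point the section is continuous. *)
Lemma deck_base : \forall w \near b0, \forall x \near w, deck w x = 1%g.
Proof.
have s0b : s b0 = e0 by rewrite -pe0 s0.
have U0 : U e0 (s b0) by rewrite s0b.
have := near_sheet (sU e0).1 U0; apply: filterS => w [g Ug _].
have {Ug} Uw : U e0 (s w).
  by rewrite -(ps w) -(orbit_map_act g) s0.
have := near_sheet (openI (sU (s w)).1 (sU e0).1) (conj (Uid _) Uw).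
apply: filterS => x [h [Uh U0h] _]; apply: deckE; rewrite (act1 cact).
by rewrite -(ps x) -(orbit_map_act h) s0.
Qed.

Lemma lift_continuous (Q : topologicalType) (f : Q -> B) g : continuous f ->
  is_lift (along deck f) g -> continuous (fun q => act (g q) (s (f q))).
Proof.
move=> cf lg q A /=; rewrite nbhsE => -[O [oO Oq] OA].
have oV : open (U (s (f q)) `&` act (g q) @^-1` O).
  apply: openI; first exact: (sU _).1.
  by apply: open_comp => // e _; exact: (act_cts cact).
have N := cf q _ (near_sheet oV (conj (Uid _) Oq)).
rewrite nbhs_simpl /=; near=> r; apply: OA.
have [h [Uh Oh] _] : exists2 h, (U (s (f q)) `&` act (g q) @^-1` O) (act h (s (f r))) & True.
  by near: r; exact: N.
have -> : g r = (g q * deck (f q) (f r))%g by near: r; exact: lg.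
by rewrite (deckE Uh) (actM cact).
Unshelve. all: by end_near. Qed.

(** Conversely, the fibre coordinate of a continuous map to [E] is a primitive. *)
Lemma is_lift_continuous (Q : topologicalType) (k : Q -> E) g : continuous k ->
  (forall q, k q = act (g q) (s (p (k q)))) -> is_lift (along deck (p \o k)) g.
Proof.
move=> ck kE q.
have oV : open (act (g q)^-1%g @^-1` U (s (p (k q)))).
  by apply: open_comp; [move=> e _; exact: (act_cts cact)|exact: (sU _).1].
have Vq : (act (g q)^-1%g @^-1` U (s (p (k q)))) (k q).
  by rewrite /= [X in act _ X]kE -(actM cact) mulVg (act1 cact).
have N := ck q _ (open_nbhs_nbhs (conj oV Vq)).
near=> r; rewrite /along (@deckE _ _ ((g q)^-1 * g r)%g) ?mulVKg //.
rewrite (actM cact) /= -kE; near: r; exact: N.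
Unshelve. all: by end_near. Qed.

Lemma orbit_map_continuous : continuous p.
Proof. by apply/continuousP => V oV; exact/(orbit_map_open omap). Qed.

Hypothesis cE : contractible R E.

(** Surjectivity projects a path from [e0] to its translate.  For injectivity, two
    loops with the same transport lift to paths with the same ends, which are
    homotopic because [E] is contractible. *)
Lemma deck_monodromy_bij : bijective (monodromy deck : pi1 R b0 -> G).
Proof.
have s0b : s b0 = e0 by rewrite -pe0 s0.
have surj g : exists a : pi1 R b0, monodromy deck a = g.
  have [k _] := contractible_path cE e0 (act g e0).
  have ck : continuous (p \o k).
    by move=> t; apply: continuous_comp; [exact: cts_fun|exact: orbit_map_continuous].
  have k0 : (p \o k) zero = b0 by rewrite /= path_zero.
  have k1 : (p \o k) one = b0 by rewrite /= path_one orbit_map_act.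
  exists (pi1_class (mk_path ck k0 k1)).
  have /choice[h hE] t : exists h, k t = act h (s (p (k t))).
    by apply/(orbit_map_fibre omap); rewrite ps.
  rewrite (monodromyE deck_transition).
  rewrite (transportE (is_lift_continuous (@cts_fun _ _ k) hE)).
  have e1 : U e0 (act 1%g e0) by rewrite (act1 cact).
  have := hE zero; rewrite path_zero pe0 s0b => h0.
  have -> : h zero = 1%g.
    by apply: (sheet_unique (sU e0) _ e1); rewrite -h0.
  have := hE one; rewrite path_one orbit_map_act pe0 s0b => h1.
  have : act 1%g e0 = act (g^-1 * h one)%g e0.
    by rewrite (actM cact) -h1 -(actM cact) mulVg.
  move=> h1'; have : U e0 (act (g^-1 * h one)%g e0) by rewrite -h1'.
  by move=> /(sheet_unique (sU e0) e1)/esym/mulg1_eq; rewrite invgK invg1 mul1g => ->.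
have inj : injective (monodromy deck : pi1 R b0 -> G).
  elim/pi1_ind => f; elim/pi1_ind => f'.
  rewrite !(monodromyE deck_transition) => ff'; apply/pi1_classP.
  pose c := transport deck f.
  have lf (h : {path I from b0 to b0}) : transport deck h = c ->
      exists k : {path I from e0 to act c e0}, p \o k = h.
    move=> hc; have [g lg] := lift_of_path deck_transition (@cts_fun _ _ h).
    have gc : ((g zero)^-1 * g one)%g = c by rewrite -hc (transportE lg).
    have ck := lift_continuous (@cts_fun _ _ h) (is_liftMl (g zero)^-1%g lg).
    have k0 : act ((g zero)^-1 * g zero)%g (s (h zero)) = e0.
      by rewrite mulVg path_zero s0b (act1 cact).
    have k1 : act ((g zero)^-1 * g one)%g (s (h one)) = act c e0.
      by rewrite gc path_one s0b.
    exists (mk_path ck k0 k1); apply/funext => t.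
    by rewrite /= /mk_path orbit_map_act ps.
  have [k kE] := lf f erefl.
  have [k' kE'] := lf f' (esym ff').
  have [H [cH H0 H1 Hx Hy]] := contractible_homotopic cE k k'.
  exists (p \o H); split.
  - by move=> st; apply: continuous_comp; [exact: cH|exact: orbit_map_continuous].
  - by move=> t; rewrite /= H0 -[RHS](congr1 (fun h => h t) kE).
  - by move=> t; rewrite /= H1 -[RHS](congr1 (fun h => h t) kE').
  - by move=> t; rewrite /= Hx.
  - by move=> t; rewrite /= Hy orbit_map_act.
have /choice[inv invE] := surj.
by exists inv => // a; apply: inj; rewrite invE.
Qed.

End Covering.

Section OrbitSpace.
Variables (R : realType) (G : groupType) (E B : topologicalType).
Variables (act : G -> E -> E) (p : E -> B) (b0 : B).
Hypotheses (cE : contractible R E) (cact : covering_action act) (omap : orbit_map act p).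
Local Notation I := (unit_interval R).

Lemma orbit_space_transition : exists d : B -> B -> G,
  [/\ transition d, \forall w \near b0, \forall x \near w, d w x = 1%g
    & bijective (monodromy d : pi1 R b0 -> G)].
Proof.
have [U UP] := sheets_exist cact.
have sU e := (UP e).1; have Uid e := (UP e).2.
have [e0 _ pe0] : range p b0 by rewrite (orbit_map_surj omap).
have [s [ps s0]] := section_exists cact omap e0 sU.
exists (deck act U s); split.
- exact: (deck_transition cact omap sU Uid ps).
- exact: (deck_base cact omap sU Uid pe0 ps s0).
- exact: (deck_monodromy_bij cact omap sU Uid pe0 ps s0 cE).
Qed.

Lemma orbit_space_path b : exists k : {path I from b to b0}, True.
Proof.
have [e _ <-] : range p b by rewrite (orbit_map_surj omap).
have [e0 _ <-] : range p b0 by rewrite (orbit_map_surj omap).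
have [k _] := contractible_path cE e e0.
have ck : continuous (p \o k).
  by move=> t; apply: continuous_comp; [exact: cts_fun|exact: (@orbit_map_continuous _ _ _ _ _ omap)].
have k0 : (p \o k) zero = p e by rewrite /= path_zero.
have k1 : (p \o k) one = p e0 by rewrite /= path_one.
by exists (mk_path ck k0 k1).
Qed.

End OrbitSpace.

(** * Discs *)

Section Discs.
Variable R : realType.

Definition rnorm k (v : 'rV[R]_k) : R := Num.sqrt (\sum_i v 0 i ^+ 2).

Let sum_ge0 k (v : 'rV[R]_k) : 0 <= \sum_i v 0 i ^+ 2.
Proof. by apply: sumr_ge0 => i _; exact: sqr_ge0. Qed.

Lemma rnorm_le1 k (v : 'rV[R]_k) : (rnorm v <= 1) = (\sum_i v 0 i ^+ 2 <= 1).
Proof. by rewrite -{1}sqrtr1 ler_sqrt. Qed.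

Lemma rnorm_lt1 k (v : 'rV[R]_k) : (rnorm v < 1) = (\sum_i v 0 i ^+ 2 < 1).
Proof. by rewrite -{1}sqrtr1 ltr_sqrt. Qed.

Lemma sphereP k (v : 'rV[R]_k) : @sphere R k v <-> rnorm v = 1.
Proof.
split => [vE|vE]; first by rewrite /rnorm vE sqrtr1.
by rewrite /sphere /= -(sqr_sqrtr (sum_ge0 v)) -/(rnorm v) vE expr1n.
Qed.

Lemma rnormZ k a (v : 'rV[R]_k) : rnorm (a *: v) = `|a| * rnorm v.
Proof.
rewrite /rnorm -sqrtr_sqr -sqrtrM ?sqr_ge0 // mulr_sumr.
by congr Num.sqrt; apply: eq_bigr => i _; rewrite mxE exprMn.
Qed.

Lemma rnorm_continuous k : continuous (@rnorm k).
Proof.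
move=> v; apply: (@continuous_comp _ _ _ (fun v : 'rV[R]_k => \sum_i v 0 i ^+ 2)).
  have H := (@continuous_big R 'I_k +%R 0 xpredT (@add_continuous R) 'rV[R]_k _
    (fun i v => v 0 i ^+ 2)).
  apply: H => i _ w.
  by apply: (@continuous_comp _ _ _ (fun v : 'rV[R]_k => v 0 i) (fun x => x ^+ 2));
    [exact: coord_continuous|exact: exprn_continuous].
exact: sqrt_continuous.
Qed.

Lemma disc_compact k : compact (@disc R k).
Proof.
apply: (@subclosed_compact _ _ [set v : 'rV[R]_k | forall i, v ord0 i \in `[-1, 1]%R]).
- have -> : @disc R k = (@rnorm k) @^-1` [set x | x <= 1].
    by apply/seteqP; split => v /=; rewrite rnorm_le1.
  by apply: closed_comp; [move=> v _; exact: rnorm_continuous|exact: closed_le].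
- by apply: (@rV_compact R k (fun=> `[-1, 1]%classic)) => i; exact: segment_compact.
- move=> v /= v1 i; rewrite in_itv /=.
  have : v 0 i ^+ 2 <= 1.
    apply: le_trans v1; rewrite (bigD1 i) //= lerDl.
    by apply: sumr_ge0 => j _; exact: sqr_ge0.
  by rewrite expr2 => h; apply/andP; split; nra.
Qed.

Lemma cvg_invZ (T : Type) (V : normedModType R) (F : set_system T) (FF : Filter F)
    (m : T -> R) (f : T -> V) m0 f0 :
  m0 != 0 -> m @ F --> m0 -> f @ F --> f0 -> (m t)^-1 *: f t @[t --> F] --> m0^-1 *: f0.
Proof. by move=> m0n cm cf; apply: cvgZ => //; exact: cvgV. Qed.

(** Radial retraction onto the disc; composing with it turns characteristic maps into
    maps that are continuous everywhere. *)
Definition to_disc k (v : 'rV[R]_k) : 'rV[R]_k := (Num.max 1 (rnorm v))^-1 *: v.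

Lemma to_disc_disc k (v : 'rV[R]_k) : @disc R k (to_disc v).
Proof.
rewrite /disc /= -rnorm_le1 rnormZ.
have m1 : 1 <= Num.max 1 (rnorm v) by rewrite le_max lexx.
rewrite ger0_norm ?invr_ge0 ?(le_trans _ m1) //.
by rewrite ler_pdivrMl ?(lt_le_trans _ m1) // mulr1 le_max lexx orbT.
Qed.

Lemma to_disc_id k (v : 'rV[R]_k) : @disc R k v -> to_disc v = v.
Proof. by rewrite /disc /= -rnorm_le1 /to_disc => v1; rewrite max_l // invr1 scale1r. Qed.

Lemma to_disc_continuous k : continuous (@to_disc k).
Proof.
move=> v; apply: (@cvg_invZ _ 'rV[R]_k (nbhs v)); last exact: cvg_id.
  by rewrite gt_eqF // lt_max ltr01.
by apply: (@continuous_max R _ (fun=> 1) (@rnorm k));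
  [exact: cst_continuous|exact: rnorm_continuous].
Qed.

End Discs.

Lemma tube_open (P Q Y : topologicalType) (h : P * Q -> Y) (V : set Y) (N : set Q) :
  continuous h -> open V -> compact N ->
  open [set v | forall t, N t -> V (h (v, t))].
Proof.
move=> ch oV cN; rewrite openE => v Vv; rewrite /interior.
apply: ((compact_near_coveringP N).1 cN _ (nbhs v) (fun v t => V (h (v, t)))) => t Nt.
have := open_nbhs_nbhs (conj oV (Vv t Nt)) => /(ch (v, t))[[A B] /= [nA nB] AB].
by exists (B, A) => //= -[t' v'] /= [Bt Av]; exact: (AB (v', t')).
Qed.

(** * Collapsing a neighbourhood of a vertex of a cell complex *)

Section CellComplex.
Variables (R : realType) (X : topologicalType) (C : cw_structure R X).
Implicit Types (c d : cell C).

Definition ext_char_map c (v : 'rV[R]_(Defs.dim c)) : X := char_map (to_disc v).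

Lemma ext_char_map_id c (v : 'rV[R]_(Defs.dim c)) : disc v -> ext_char_map v = char_map v.
Proof. by move=> dv; rewrite /ext_char_map to_disc_id. Qed.

Lemma ext_char_map_continuous c : continuous (@ext_char_map c).
Proof.
have cs : continuous (sigL (@disc R (Defs.dim c)) (@char_map _ _ _ c)).
  by apply/subspace_sigL_continuousP; exact: char_map_cts.
have pf (v : 'rV[R]_(Defs.dim c)) : to_disc v \in @disc R (Defs.dim c).
  by rewrite inE; exact: to_disc_disc.
pose k v : set_type (@disc R (Defs.dim c)) := exist _ (to_disc v) (pf v).
have ck : continuous k.
  by apply: continuous_comp_initial; exact: to_disc_continuous.
by move=> v; apply: (@continuous_comp _ _ _ k (sigL (@disc R _) (@char_map _ _ _ c)));
  [exact: ck|exact: cs].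
Qed.

Lemma ext_char_map_compact c (K : set 'rV[R]_(Defs.dim c)) : closed K ->
  compact (@char_map _ _ _ c @` (@disc R (Defs.dim c) `&` K)).
Proof.
move=> cK; have -> : @char_map _ _ _ c @` (@disc R (Defs.dim c) `&` K) =
    @ext_char_map c @` (@disc R (Defs.dim c) `&` K).
  apply/seteqP; split => _ [v [dv Kv] <-]; exists v => //; first exact: ext_char_map_id.
  by rewrite ext_char_map_id.
apply: continuous_compact; first exact/continuous_subspaceT/ext_char_map_continuous.
by apply: compact_closedI => //; exact: disc_compact.
Qed.

Lemma char_map_closed c (K : set 'rV[R]_(Defs.dim c)) : closed K ->
  closed (@char_map _ _ _ c @` (@disc R (Defs.dim c) `&` K)).
Proof.
by move=> cK; apply: compact_closed; [exact: (cw_hausdorff C)|exact: ext_char_map_compact].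
Qed.

Lemma closed_cell_closed c : closed (@char_map _ _ _ c @` @disc R (Defs.dim c)).
Proof. by rewrite -[@disc _ _]setIT; exact: char_map_closed. Qed.

Lemma disc_split k (v : 'rV[R]_k) : disc v -> open_disc v \/ sphere v.
Proof.
rewrite /disc /= le_eqVlt => /orP[/eqP|]; [by right|by left].
Qed.

Lemma open_disc_disc k (v : 'rV[R]_k) : open_disc v -> disc v.
Proof. exact: ltW. Qed.

Lemma closure_open_cell c : closure (open_cell c) `<=` @char_map _ _ _ c @` @disc R (Defs.dim c).
Proof.
rewrite closureE => x; apply; split; first exact: closed_cell_closed.
by move=> _ [v ov <-]; exists v => //; exact: open_disc_disc.
Qed.

Lemma open_cell_uniq c d x : open_cell c x -> open_cell d x -> c = d.
Proof. by move=> cx dx; apply: (@open_cells_disjoint _ _ C) => //; exists x. Qed.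

Definition cell_union (D : set (cell C)) : set X := \bigcup_(c in D) open_cell c.

(** A cell outside [D] meets [A] only in its boundary, which lies in finitely many
    cells of lower dimension; those of them that meet [A] belong to [D]. *)
Lemma cell_union_weak (D : set (cell C)) (A : set X) : A `<=` cell_union D ->
  (forall c, D c -> closed (A `&` @char_map _ _ _ c @` @disc R (Defs.dim c))) -> closed A.
Proof.
move=> AD cA; apply: (@cw_weak_topology _ _ C) => c.
have [Dc|nDc] := pselect (D c).
  have -> : A `&` closure (open_cell c) =
      (A `&` @char_map _ _ _ c @` @disc R (Defs.dim c)) `&` closure (open_cell c).
    rewrite -setIA; congr (_ `&` _); rewrite setIC.
    by apply/esym/setIidPl; exact: closure_open_cell.
  by apply: closedI; [exact: cA|exact: closed_closure].
have [F finF [dF bF]] := cell_boundary c.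
have -> : A `&` closure (open_cell c) = closure (open_cell c) `&`
    \bigcup_(d in F `&` D) (A `&` @char_map _ _ _ d @` @disc R (Defs.dim d)).
  apply/seteqP; split => x.
    move=> [Ax cx]; split => //; have [e De ex] := AD x Ax.
    have [v dv vx] := closure_open_cell cx; case: (disc_split dv) => [ov|sv].
      have ce : c = e by apply: (open_cell_uniq (x := x)) => //; exists v.
      by case: nDc; rewrite ce.
    have [d Fd dx] : (\bigcup_(d in F) open_cell d) x.
      by apply: bF; exists v.
    have de : d = e by exact: open_cell_uniq dx ex.
    exists d; first by split => //; rewrite de.
    split => //; case: dx => w ow wx; exists w => //; exact: open_disc_disc.
  by move=> [cx [d _ [Ax _]]].
apply: closedI; first exact: closed_closure.
apply: (@closed_bigcup X {classic (cell C)}) => [|d [_ Dd]]; last exact: cA.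
by apply: sub_finite_set finF => d [].
Qed.

(** The product of a complex with the line has the topology determined by the cells
    times the line, because the line is locally compact: for a compact interval
    [N], the points [x] with [f (x, t)] in a given open set for all [t] in [N] form a
    set that is open over every cell by the tube lemma. *)
Lemma cell_union_cvg (D : set (cell C)) (Y : topologicalType) (f : X * R -> Y)
    (T : Type) (F : set_system T) (FF : Filter F) (a : T -> X) (b : T -> R) x0 t0 :
  (forall c, D c -> @char_map _ _ _ c @` @disc R (Defs.dim c) `<=` cell_union D) ->
  (forall c, D c ->
    continuous (fun z : 'rV[R]_(Defs.dim c) * R => f (ext_char_map z.1, z.2))) ->
  cell_union D x0 -> (\forall t \near F, cell_union D (a t)) ->
  a @ F --> x0 -> b @ F --> t0 ->
  f (a t, b t) @[t --> F] --> f (x0, t0).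
Proof.
move=> DD cf Dx0 Da ca cb V /=; rewrite nbhsE => -[O [oO Oxt] OV].
have [e e0 eO] : exists2 e : R, 0 < e & forall t, `|t0 - t| <= e -> O (f (x0, t)).
  have [c Dc [v ov vx]] := Dx0.
  have cft : continuous (fun t : R => f (x0, t)).
    have -> : (fun t => f (x0, t)) =
        (fun z : 'rV[R]_(Defs.dim c) * R => f (ext_char_map z.1, z.2)) \o (fun t => (v, t)).
      by apply/funext => t /=; rewrite ext_char_map_id ?vx //; exact: open_disc_disc.
    by move=> t; apply: continuous_comp; [exact: continuous_pairr|exact: cf].
  have := cft t0 _ (open_nbhs_nbhs (conj oO Oxt)).
  move=> /nbhs_ballP[e /= e0 eO]; exists (e / 2); first by rewrite divr_gt0.
  by move=> t te; apply: eO; rewrite /ball /=; apply: le_lt_trans te _; lra.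
pose N := `[t0 - e, t0 + e]%classic.
pose W := [set x | forall t, N t -> O (f (x, t))].
have Wx0 : W x0.
  by move=> t; rewrite /N /= in_itv /= => tN; apply: eO; rewrite ler_norml; lra.
have cA : closed (cell_union D `\` W).
  apply: (cell_union_weak (D := D)) => [x []//|c Dc].
  have -> : (cell_union D `\` W) `&` @char_map _ _ _ c @` @disc R (Defs.dim c) =
     @char_map _ _ _ c @` (@disc R (Defs.dim c) `&`
       ~` [set v | forall t, N t -> O (f (ext_char_map v, t))]).
    apply/seteqP; split => x.
      move=> [[Dx nW] [v dv vx]]; exists v => //; split => // Wv.
      by apply: nW; rewrite /W /= -vx -(ext_char_map_id dv).
    move=> [v [dv nv] <-]; split; last by exists v.
    split; first by apply: (DD c Dc); exists v.
    by rewrite /W /= -(ext_char_map_id dv).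
  apply: char_map_closed; apply: open_closedC.
  apply: (tube_open (cf c Dc) oO); exact: segment_compact.
have nA : nbhs x0 (~` (cell_union D `\` W)).
  by apply: open_nbhs_nbhs; split; [exact: closed_openC|move=> []].
have nN : nbhs t0 N.
  by apply/nbhs_ballP; exists e => // t; rewrite /ball /= /N /= in_itv /= ltr_norml; lra.
rewrite nbhs_simpl /=; near=> t; apply: OV.
have Dat : cell_union D (a t) by near: t.
have nAt : (~` (cell_union D `\` W)) (a t) by near: t; exact: ca.
have Nt : N (b t) by near: t; exact: cb.
by apply: contrapT => nO; apply: nAt; split => // Wt; apply: nO; exact: Wt.
Unshelve. all: by end_near. Qed.

Lemma cell_coords : exists cv : X -> {c : cell C & 'rV[R]_(Defs.dim c)},
  forall x, open_disc (projT2 (cv x)) /\ char_map (projT2 (cv x)) = x.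
Proof.
have /choice[cv cvP] : forall x, exists cv : {c : cell C & 'rV[R]_(Defs.dim c)},
    open_disc (projT2 cv) /\ char_map (projT2 cv) = x; last by exists cv.
move=> x; have : (\bigcup_c @open_cell _ _ C c) x by rewrite (open_cells_cover C).
by case=> c _ [v ov vx]; exists (existT _ c v).
Qed.

Section Retraction.
Variables (pt : X) (c0 : cell C) (cv : X -> {c : cell C & 'rV[R]_(Defs.dim c)}).
Hypothesis c0E : open_cell c0 = [set pt].
Hypothesis cvP : forall x, open_disc (projT2 (cv x)) /\ char_map (projT2 (cv x)) = x.

Lemma cell_coordsE c (v : 'rV[R]_(Defs.dim c)) : open_disc v ->
  cv (char_map v) = existT _ c v.
Proof.
move=> ov; have := cvP (char_map v); case: (cv _) => d w /= [ow wv].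
have dc : d = c.
  by apply: (@open_cell_uniq d c (char_map v)); [exists w|exists v].
move: w ow wv; rewrite dc => w ow wv; congr existT.
by apply: (@char_map_inj _ _ C c) => //; rewrite inE.
Qed.

Let height (x : X) := Defs.dim (projT1 (cv x)).

(** What makes the recursion over dimensions terminate. *)
Lemma height_sphere c (v : 'rV[R]_(Defs.dim c)) : sphere v ->
  (height (char_map v) < Defs.dim c)%N.
Proof.
move=> sv; have [F _ [dF bF]] := cell_boundary c.
have [d Fd [w ow <-]] : (\bigcup_(d in F) open_cell d) (char_map v).
  by apply: bF; exists v.
by rewrite /height cell_coordsE //=; exact: dF.
Qed.

(** The retraction of the cylinder [X * [0, 1]] onto [X * {0}] joined with
    [{pt} * [0, 1]].  Over a cell it projects from the point at height 2 over
    the centre; what lands on the lateral boundary is pushed on inside the cells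
    of lower dimension.  The argument [n] bounds the number of these steps. *)
Fixpoint push n (x : X) (t : R) : X * R :=
  if n is n'.+1 then
    if x == pt then (pt, t) else
    let: existT c v := cv x in
    if rnorm v <= 1 - t / 2 then (char_map ((1 - t / 2)^-1 *: v), 0)
    else push n' (char_map ((rnorm v)^-1 *: v)) (2 - (2 - t) / rnorm v)
  else (x, 0).

Definition retract (z : X * R) : X * R := push (height z.1).+1 z.1 (clamp01 z.2).

Let scale_sphere k (v : 'rV[R]_k) : 0 < rnorm v -> sphere ((rnorm v)^-1 *: v).
Proof.
by move=> v0; apply/sphereP; rewrite rnormZ gtr0_norm ?invr_gt0 // mulVf // gt_eqF.
Qed.

Let lateral_le (r t : R) : 0 < r -> r <= 1 -> t <= 2 -> 2 - (2 - t) / r <= t.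
Proof.
move=> r0 r1 t2; rewrite lerBlDr -lerBlDl ler_pdivlMr //.
by rewrite ler_piMr // subr_ge0.
Qed.

Let lateral_ge0 (r t : R) : 0 < r -> 1 - t / 2 <= r -> 0 <= 2 - (2 - t) / r.
Proof. by move=> r0 tr; rewrite subr_ge0 ler_pdivrMr //; lra. Qed.

Lemma push_fuel n m x t : t <= 1 -> (height x < n)%N -> (height x < m)%N ->
  push n x t = push m x t.
Proof.
elim: n m x t => [|n IH] [|m] x t t1 //=; case: eqP => // _.
rewrite /height; have := cvP x; case: (cv x) => c v /= [ov _] cn cm.
case: ifPn => //; rewrite -ltNge => tv.
have v0 : 0 < rnorm v by apply: le_lt_trans tv; lra.
have v1 : rnorm v <= 1 by rewrite rnorm_le1; exact: open_disc_disc.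
have hs := height_sphere (scale_sphere v0).
apply: IH; last 2 first.
- exact: leq_trans hs cn.
- exact: leq_trans hs cm.
by apply: (le_trans _ t1); apply: lateral_le => //; lra.
Qed.

Lemma clamp01_id (t : R) : 0 <= t <= 1 -> clamp01 t = t.
Proof. exact: clampK. Qed.

Lemma clamp01_bounds (t : R) : 0 <= clamp01 t <= 1.
Proof. by have := clamp01_itv t; rewrite inE /= in_itv. Qed.

Lemma retract_pt t : retract (pt, t) = (pt, clamp01 t).
Proof. by rewrite /retract /= eqxx. Qed.

Lemma retract0 x : retract (x, 0) = (x, 0).
Proof.
rewrite /retract /= clamp01_id ?lexx ?ler01 //; case: eqP => [->//|_].
have := cvP x; case: (cv x) => c v /= [ov vx].
by rewrite mul0r subr0 rnorm_le1 open_disc_disc // invr1 scale1r vx.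
Qed.

Lemma retract_or z : (retract z).1 = pt \/ (retract z).2 = 0.
Proof.
suff H n x t : (push n x t).1 = pt \/ (push n x t).2 = 0 by exact: H.
elim: n x t => [|n IH] x t /=; first by right.
by case: eqP => _; [left|case: (cv x) => c v; case: ifP => _; [right|exact: IH]].
Qed.

(** The defining equation, extended to the boundary of the disc. *)
Lemma retract_cell c (v : 'rV[R]_(Defs.dim c)) t : c <> c0 -> disc v -> 0 <= t <= 1 ->
  retract (char_map v, t) =
    if rnorm v <= 1 - t / 2 then (char_map ((1 - t / 2)^-1 *: v), 0)
    else retract (char_map ((rnorm v)^-1 *: v), 2 - (2 - t) / rnorm v).
Proof.
move=> cc0 dv t01; case: (disc_split dv) => [ov|/sphereP v1]; last first.
  rewrite v1; case: ifPn => [tle|_].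
    have -> : t = 0 by lra.
    by rewrite mul0r subr0 invr1 scale1r retract0.
  by rewrite invr1 scale1r mulr1 opprB addrC subrK.
rewrite {1}/retract /= clamp01_id //.
have -> : (char_map v == pt) = false.
  apply/eqP => vpt; apply: cc0; apply: (@open_cell_uniq _ _ pt); last by rewrite c0E.
  by exists v.
rewrite /height cell_coordsE //=; case: ifPn => //; rewrite -ltNge => tv.
have v0 : 0 < rnorm v by apply: le_lt_trans tv; lra.
have v1 : rnorm v <= 1 by rewrite rnorm_le1.
have s1 := @lateral_le (rnorm v) t v0 v1 ltac:(lra).
have s0 := @lateral_ge0 (rnorm v) t v0 (ltW tv).
rewrite /retract /= clamp01_id; last by rewrite s0 (le_trans s1) //; lra.
apply: (@push_fuel _ _.+1) => //; first by apply: le_trans s1 _; lra.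
exact: height_sphere (scale_sphere v0).
Qed.

(** The cell of the base point has dimension zero, as the centre of its disc and
    half a boundary point would otherwise have the same image. *)
Lemma base_cell (v : 'rV[R]_(Defs.dim c0)) : disc v -> char_map v = pt.
Proof.
have img (w : 'rV[R]_(Defs.dim c0)) : open_disc w -> char_map w = pt.
  by move=> ow; have : open_cell c0 (char_map w) by [exists w]; rewrite c0E.
move=> dv; case: (disc_split dv) => [/img//|/sphereP v1].
have o0 : @open_disc R _ (0 : 'rV[R]_(Defs.dim c0)).
  by rewrite /open_disc /= -rnorm_lt1 -(scale0r v) rnormZ normr0 mul0r ltr01.
have oh : open_disc (2^-1 *: v).
  by rewrite /open_disc /= -rnorm_lt1 rnormZ v1 gtr0_norm; lra.
have : 2^-1 *: v = 0.
  by apply: (@char_map_inj _ _ C c0); rewrite ?inE // !img.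
move=> /(congr1 (@rnorm R _)); rewrite rnormZ v1 -(scale0r v) rnormZ normr0 mul0r.
by rewrite gtr0_norm ?invr_gt0 // => ?; exfalso; lra.
Qed.

Lemma clamp01_continuous : continuous (@clamp01 R).
Proof.
move=> r; apply: (@continuous_comp _ _ _ (@clamp R) (@ival R));
  [exact: clamp_continuous|exact: ival_continuous].
Qed.

Lemma retract_clamp x t : retract (x, clamp01 t) = retract (x, t).
Proof. by rewrite /retract /= clamp01_id // clamp01_bounds. Qed.

(** By induction on the dimension.  Over the part of the cylinder that is projected to
    its base the map is explicit; over the part that is projected to the lateral
    boundary it factors through the cells of lower dimension, where
    [cell_union_cvg] applies. *)
Lemma retract_cell_continuous c :
  continuous (fun z : 'rV[R]_(Defs.dim c) * R => retract (ext_char_map z.1, z.2)).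
Proof.
have [n] := ubnP (Defs.dim c); elim: n c => // n IH c /ltnSE cn.
have [cc0|cc0] := pselect (c = c0).
  move: IH cn; rewrite cc0 => _ _.
  have -> : (fun z : 'rV[R]_(Defs.dim c0) * R => retract (ext_char_map z.1, z.2)) =
      (fun z => (pt, clamp01 z.2)).
    apply/funext => z; rewrite /ext_char_map base_cell ?retract_pt //.
    exact: to_disc_disc.
  apply: continuous_pair => z; first exact: cst_continuous.
  by apply: (@continuous_comp _ _ _ snd); [exact: cvg_snd|exact: clamp01_continuous].
pose u (z : 'rV[R]_(Defs.dim c) * R) := to_disc z.1.
pose r z := rnorm (u z).
pose m (z : 'rV[R]_(Defs.dim c) * R) : R := 1 - clamp01 z.2 / 2.
have cu : continuous u.
  by move=> z; apply: (@continuous_comp _ _ _ fst); [exact: cvg_fst|exact: to_disc_continuous].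
have cr : continuous r.
  by move=> z; apply: (@continuous_comp _ _ _ u); [exact: cu|exact: rnorm_continuous].
have ct : continuous (fun z : 'rV[R]_(Defs.dim c) * R => clamp01 z.2).
  by move=> z; apply: (@continuous_comp _ _ _ snd); [exact: cvg_snd|exact: clamp01_continuous].
have cm : continuous m.
  move=> z; apply: cvgB; first exact: cst_continuous.
  by apply: cvgM; [exact: ct|exact: cst_continuous].
have m12 z : 2^-1 <= m z <= 1.
  by rewrite /m; have := clamp01_bounds z.2; lra.
have m0 z : 0 < m z by have := m12 z; lra.
(* [A] is the value below the cone [r = m], [B] the value above it. *)
pose A z := (ext_char_map ((m z)^-1 *: u z), 0 : R).
pose B z := retract (ext_char_map ((r z)^-1 *: u z), 2 - (2 - clamp01 z.2) / r z).
have E z : retract (ext_char_map z.1, z.2) = if r z <= m z then A z else B z.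
  rewrite -retract_clamp /A /B /ext_char_map retract_cell //;
    [|exact: to_disc_disc|exact: clamp01_bounds].
  rewrite -/(u z) -/(r z) -/(m z); case: ifPn => rm.
    rewrite to_disc_id // /disc /= -rnorm_le1 rnormZ gtr0_norm ?invr_gt0 //.
    by rewrite ler_pdivrMl // mulr1.
  have r0 : 0 < r z by move: rm; rewrite -ltNge; exact: lt_trans.
  rewrite to_disc_id // /disc /= -rnorm_le1.
  by have /sphereP -> := scale_sphere r0.
have cA : continuous A.
  apply: continuous_pair => z; last exact: cst_continuous.
  apply: (@continuous_comp _ _ _ (fun z => (m z)^-1 *: u z)); last exact: ext_char_map_continuous.
  by apply: cvg_invZ; [rewrite gt_eqF|exact: cm|exact: cu].
pose D d := (Defs.dim d < Defs.dim c)%N.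
have DD d : D d -> @char_map _ _ _ d @` @disc R (Defs.dim d) `<=` cell_union D.
  move=> Dd _ [v dv <-]; have [ov wv] := cvP (char_map v).
  have [ov'|sv] := disc_split dv; first by exists d => //; exists v.
  have := height_sphere sv; rewrite /height => h.
  exists (projT1 (cv (char_map v))); first exact: ltn_trans h Dd.
  by exists (projT2 (cv (char_map v))).
have Dsph z : 0 < r z -> cell_union D (ext_char_map ((r z)^-1 *: u z)).
  move=> r0; have sz := scale_sphere r0.
  rewrite ext_char_map_id; last by rewrite /disc /= -rnorm_le1; have /sphereP -> := sz.
  have [ov wv] := cvP (char_map ((r z)^-1 *: u z)).
  exists (projT1 (cv (char_map ((r z)^-1 *: u z)))); first exact: (height_sphere sz).
  by exists (projT2 (cv (char_map ((r z)^-1 *: u z)))).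
have cB z : 0 < r z -> B @ (within [set z | 0 < r z] (nbhs z)) --> B z.
  move=> r0; rewrite /B; apply: (@cell_union_cvg D) => //.
  - move=> d Dd; apply: IH; exact: leq_trans Dd cn.
  - exact: Dsph.
  - by apply: filterS (withinT [set z | 0 < r z] _) => z'; exact: Dsph.
  - apply: (@cvg_within_filter _ _ (fun z => ext_char_map ((r z)^-1 *: u z)) (nbhs z)).
    apply: (@continuous_comp _ _ _ (fun z => (r z)^-1 *: u z)); last exact: ext_char_map_continuous.
    by apply: cvg_invZ; [rewrite gt_eqF|exact: cr|exact: cu].
  - apply: (@cvg_within_filter _ _ (fun z => 2 - (2 - clamp01 z.2) / r z) (nbhs z)).
    apply: cvgB; first exact: cst_continuous.
    apply: cvgM; first by apply: cvgB; [exact: cst_continuous|exact: ct].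
    by apply: cvgV; [rewrite gt_eqF|exact: cr].
move=> z V /=; rewrite E => nV; rewrite nbhs_simpl /=.
have c_rm : continuous (fun z => m z - r z) by move=> w; apply: cvgB; [exact: cm|exact: cr].
have near_lt : m z < r z -> \forall w \near z, m w < r w.
  move=> h; have : \forall w \near z, m w - r w < 0.
    by apply: (c_rm z [set x | x < 0]); apply: lt_nbhsl; lra.
  by apply: filterS => w; lra.
have near_gt : r z < m z -> \forall w \near z, r w < m w.
  move=> h; have : \forall w \near z, 0 < m w - r w.
    by apply: (c_rm z [set x | 0 < x]); apply: lt_nbhsr; lra.
  by apply: filterS => w; lra.
have AV : \forall w \near z, r w <= m w -> V (A w).
  have [/near_lt|h] := ltP (m z) (r z).
    by apply: filterS => w h; rewrite leNgt h.
  by move: nV; rewrite h => /(cA z) nA; near=> w => _; near: w; exact: nA.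
have rB : m z <= r z -> B z = if r z <= m z then A z else B z.
  case: ifPn => // h1 h2; have rm : r z = m z by apply/eqP; rewrite eq_le h1 h2.
  rewrite /A /B rm /m.
  have -> : 2 - (2 - clamp01 z.2) / (1 - clamp01 z.2 / 2) = 0.
    have := m0 z; rewrite /m => mz.
    have -> : 2 - clamp01 z.2 = 2 * (1 - clamp01 z.2 / 2) by lra.
    by rewrite mulfK ?subrr // gt_eqF.
  by rewrite retract0.
have BV : \forall w \near z, m w < r w -> V (B w).
  have [/near_gt|h] := ltP (r z) (m z).
    by apply: filterS => w h; rewrite ltNge ltW.
  move: nV; rewrite -rB // => nV.
  have r0 : 0 < r z by exact: lt_le_trans (m0 z) h.
  have := cB z r0 V nV; rewrite nbhs_simpl /within /= => H.
  near=> w => mrw; have r0w : 0 < r w by exact: lt_trans (m0 w) mrw.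
  by move: r0w; near: w; exact: H.
near=> w; rewrite /preimage /= E; case: ifPn; rewrite -?ltNge => h.
  by move: h; near: w.
by move: h; near: w.
Unshelve. all: by end_near. Qed.

Lemma retract_continuous : continuous retract.
Proof.
move=> [x t]; have := @cell_union_cvg setT _ retract (X * R)%type (nbhs (x, t)) _ fst snd x t.
rewrite (_ : (fun z : X * R => retract (z.1, z.2)) = retract); last first.
  by apply/funext => -[].
have T y : cell_union setT y by have : (\bigcup_c @open_cell _ _ C c) y by rewrite (open_cells_cover C).
apply => //.
- by move=> c _ y _; exact: T.
- by move=> c _; exact: retract_cell_continuous.
- by apply: nearW => z; exact: T.
- exact: cvg_fst.
- exact: cvg_snd.
Qed.

End Retraction.
End CellComplex.

(** [h] and [tau] are the two components of the retraction of the cylinder: where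
    [tau] is positive at time 1, the point has been retracted to the line over [pt],
    that is [h] has reached [pt]. *)
Lemma cw_point_collapse (R : realType) (X : topologicalType) (pt : X) :
  cw_pair R [set pt] -> exists (h : X * R -> X) (U : set X),
  [/\ continuous h, forall x, h (x, 0) = x, forall t, h (pt, t) = pt,
      nbhs pt U & forall x, U x -> h (x, 1) = pt].
Proof.
move=> [C [D DE _]].
have [c0 Dc0 ptc0] : (\bigcup_(c in D) open_cell c) pt by rewrite -DE.
have c0E : @open_cell _ _ C c0 = [set pt].
  apply/seteqP; split => [x cx|_ ->//].
  by rewrite DE; exists c0.
have [cv cvP] := cell_coords C.
pose h z := (retract pt cv z).1; pose tau x := (retract pt cv (x, 1)).2.
have cr := retract_continuous c0E cvP.
have ch : continuous h.
  by move=> z; apply: (@continuous_comp _ _ _ _ fst); [exact: cr|exact: cvg_fst].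
have ctau : continuous tau.
  move=> x; apply: (@continuous_comp _ _ _ (fun x => retract pt cv (x, 1)) snd).
    by apply: (@continuous_comp _ _ _ (fun x : X => (x, 1 : R)) (retract pt cv));
      [exact: continuous_pairl|exact: cr].
  exact: cvg_snd.
exists h, [set x | 0 < tau x]; split => //.
- by move=> x; rewrite /h (retract0 pt cvP).
- by move=> t; rewrite /h retract_pt.
- apply: (ctau pt [set r | 0 < r]); apply: lt_nbhsr.
  by rewrite /tau retract_pt /= clamp01_id ?ltr01 // lexx ler01.
- move=> x /= tx; rewrite /h; have [//|t0] := retract_or pt cv (x, 1).
  by move: tx; rewrite /tau t0 ltxx.
Qed.

(** * Graph products *)

Section GraphProductTheory.
Variables (S : choiceType) (e : rel S) (G : S -> groupType).
Local Notation GP := (graph_product e G).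

Definition gp_in s (g : G s) : GP := gq_class (graph_commutation e (G := G)) (fp_in g).

Lemma gq_classM (a b : free_product G) :
  (gq_class (graph_commutation e (G := G)) a * gq_class _ b)%g =
  gq_class (graph_commutation e (G := G)) (a * b)%g.
Proof. exact: gq_mulE. Qed.

Lemma fp_classM (u v : seq {s : S & G s}) :
  (fp_class u * fp_class v)%g = fp_class (u ++ v).
Proof. exact: fp_mulE. Qed.

Lemma gp_inM s : {morph @gp_in s : g h / (g * h)%g}.
Proof.
move=> g h; rewrite /gp_in gq_classM fp_classM; congr gq_class.
exact/fp_classP/word_equiv_sym/word_equiv_mul.
Qed.

Lemma gp_in1 s : gp_in (1%g : G s) = 1%g.
Proof. by apply: (@mulgI _ (gp_in (1%g : G s))); rewrite -gp_inM !mulg1. Qed.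

Lemma gp_in_commute s t (g : G s) (h : G t) : e s t -> commute (gp_in g) (gp_in h).
Proof.
move=> est; rewrite /commute /gp_in !gq_classM.
by apply/gq_classP/gen_congr_base; exact: GraphCommutation.
Qed.

Lemma gp_ind (P : GP -> Prop) :
  P 1%g -> (forall s (g : G s) a, P a -> P (gp_in g * a)%g) -> forall a, P a.
Proof.
move=> P1 PM; elim/gq_ind; elim/fp_ind; elim=> [|[s g] u IH]; first exact: P1.
by have := PM s g _ IH; rewrite gq_classM fp_classM.
Qed.

Section Universal.
Variables (H : groupType) (phi : forall s, G s -> H).
Hypothesis phiM : forall s, {morph @phi s : g h / (g * h)%g}.
Hypothesis phi_commute : forall s t (g : G s) (h : G t), e s t ->
  commute (phi g) (phi h).

Let word_map (u : seq {s : S & G s}) : H :=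
  foldr (fun x a => phi (tagged x) * a)%g 1%g u.

Let word_map_cat u v : word_map (u ++ v) = (word_map u * word_map v)%g.
Proof. by elim: u => [|x u IH] /=; rewrite ?mul1g // IH mulgA. Qed.

Let phi1 s : phi (1%g : G s) = 1%g.
Proof. by apply: (@mulgI _ (phi (1%g : G s))); rewrite -phiM !mulg1. Qed.

Let word_map_equiv u v : word_equiv u v -> word_map u = word_map v.
Proof.
elim=> {u v} [s|s g h|u|u v _ ->|u v w _ -> _ ->|u u' v v' _ uu _ vv] //=.
- by rewrite phi1 mulg1.
- by rewrite !mulg1 phiM.
- by rewrite !word_map_cat uu vv.
Qed.

Let fp_map (a : free_product G) : H := word_map (repr (a : {eq_quot word_eqrel G})).

Let fp_mapE u : fp_map (fp_class u) = word_map u.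
Proof. by apply: word_map_equiv; apply/fp_classP; exact: fp_repK. Qed.

Let fp_mapM : {morph fp_map : a b / (a * b)%g}.
Proof.
by elim/fp_ind => u; elim/fp_ind => v; rewrite fp_classM !fp_mapE word_map_cat.
Qed.

Let fp_map_congr a b : gen_congr (graph_commutation e (G := G)) a b -> fp_map a = fp_map b.
Proof.
elim=> {a b} [_ _ [s t g h est]|a|a b _ ->|a b c _ -> _ ->|a a' b b' _ aa _ bb] //.
  by rewrite !fp_mapM !fp_mapE /= !mulg1; exact: phi_commute.
by rewrite !fp_mapM aa bb.
Qed.

Let gp_map (c : GP) : H :=
  fp_map (repr (c : {eq_quot gen_eqrel (graph_commutation e (G := G))})).

Let gp_mapE a : gp_map (gq_class _ a) = fp_map a.
Proof. by apply: fp_map_congr; apply/gq_classP; exact: gq_repK. Qed.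

Lemma gp_universal : exists f : GP -> H,
  {morph f : a b / (a * b)%g} /\ forall s (g : G s), f (gp_in g) = phi g.
Proof.
exists gp_map; split.
  by elim/gq_ind => a; elim/gq_ind => b; rewrite gq_classM !gp_mapE fp_mapM.
by move=> s g; rewrite gp_mapE fp_mapE /= mulg1.
Qed.

End Universal.
End GraphProductTheory.

(** * Polyhedral products *)

Section Pi1Map.
Variables (R : realType) (X Y : topologicalType) (f : X -> Y) (x : X) (y : Y).
Hypotheses (cf : continuous f) (fx : f x = y).
Local Notation I := (unit_interval R).

Lemma comp_path_continuous a b (p : {path I from a to b}) : continuous (f \o p).
Proof. by move=> t; apply: continuous_comp; [exact: cts_fun|exact: cf]. Qed.

Lemma comp_loop_zero (p : {path I from x to x}) : (f \o p) zero = y.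
Proof. by rewrite /= path_zero. Qed.

Lemma comp_loop_one (p : {path I from x to x}) : (f \o p) one = y.
Proof. by rewrite /= path_one. Qed.

Definition loop_map (p : {path I from x to x}) : {path I from y to y} :=
  mk_path (@comp_path_continuous _ _ p) (comp_loop_zero p) (comp_loop_one p).

Definition pi1_map (a : pi1 R x) : pi1 R y :=
  pi1_class (loop_map (repr (a : {eq_quot loop_equiv R x}))).

Lemma loop_map_homotopic p q : path_homotopic p q ->
  path_homotopic (loop_map p) (loop_map q).
Proof.
move=> [H [cH H0 H1 Hx Hy]]; exists (f \o H); split => /=.
- by move=> t; apply: continuous_comp; [exact: cH|exact: cf].
- by move=> s; rewrite H0.
- by move=> s; rewrite H1.
- by move=> t; rewrite Hx.
- by move=> t; rewrite Hy.
Qed.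

Lemma pi1_mapE p : pi1_map (pi1_class p) = pi1_class (loop_map p).
Proof. by apply/pi1_classP/loop_map_homotopic/pi1_classP; exact: pi1_repK. Qed.

Lemma pi1_mapM : {morph pi1_map : a b / (a * b)%g}.
Proof.
elim/pi1_ind => p; elim/pi1_ind => q; rewrite pi1_classM !pi1_mapE pi1_classM.
congr pi1_class; apply/path_eqP => s.
by rewrite /= /mk_path /= /mk_path /= /concat_fun; case: ifP.
Qed.

End Pi1Map.

Section PolyhedralProductTopology.
Variables (n : nat) (K : simplicial_complex n) (X : 'I_n -> topologicalType).
Variable pt : forall i, X i.
Local Notation Z := (ZK K pt).

Definition coord (i : 'I_n) (z : Z) : X i := (val z : prod_topology X) i.

(** The smallest simplex over which a point lies; membership in the polyhedral product
    is a condition on it alone. *)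
Definition supp (x : forall i, X i) : {set 'I_n} := [set i | x i != pt i]%SET.

Lemma supp_sub (x : forall i, X i) (s : {set 'I_n}) :
  (forall i, i \notin s -> x i = pt i) -> supp x \subset s.
Proof.
move=> xs; apply/fintype.subsetP => i; rewrite inE; apply: contraNT => /xs ->.
exact: eqxx.
Qed.

Lemma supp_notin (x : forall i, X i) i : i \notin supp x -> x i = pt i.
Proof. by rewrite inE negbK => /eqP. Qed.

Lemma supp_coord (z : Z) : supp (coord^~ z) \in faces K.
Proof.
have := valP z; rewrite inE => -[s /= sK zs].
apply: faces_sub sK _; apply: supp_sub => i /negbTE si.
by have := zs i; rewrite si.
Qed.

Lemma in_polyhedral (x : prod_topology X) : supp x \in faces K ->
  x \in polyhedral_product K (fun i => [set pt i]).
Proof.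
move=> xK; rewrite inE; exists (supp x) => //= i.
by case: ifPn => // /supp_notin.
Qed.

Definition to_ZK (x : forall i, X i) (xK : supp x \in faces K) : Z :=
  exist _ (x : prod_topology X) (@in_polyhedral x xK).

Lemma coord_to_ZK x xK i : coord i (@to_ZK x xK) = x i. Proof. by []. Qed.

Lemma ZK_eq (z w : Z) : (forall i, coord i z = coord i w) -> z = w.
Proof. by move=> zw; apply: val_inj; apply: functional_extensionality_dep. Qed.

Lemma coord_pt i : coord i (ZK_pt K pt) = pt i. Proof. by []. Qed.

Lemma ZK_coord_continuous i : continuous (coord i).
Proof.
move=> z; apply: (@continuous_comp _ _ _ (fun z : Z => (val z : prod_topology X))
  (@proj _ X i)); first exact: initial_continuous.
exact: proj_continuous.
Qed.

Lemma ZK_continuous (T : topologicalType) (f : T -> Z) :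
  (forall i, continuous (fun t => coord i (f t))) -> continuous f.
Proof.
move=> cf; apply: continuous_comp_initial => t.
apply/cvg_sup => i U /= [B [[V oV VE] Bt] BU].
have : nbhs t ((fun t => coord i (f t)) @^-1` V).
  apply: cf; apply: open_nbhs_nbhs; split => //.
  by move: Bt; rewrite -VE.
by apply: filterS => u Vu; apply: BU; rewrite -VE.
Qed.

End PolyhedralProductTopology.

(** * The monodromy of a polyhedral product *)

Lemma prodgM_distinct (I : eqType) (H : groupType) (r : seq I) (F1 F2 : I -> H) :
  uniq r -> (forall i j, i != j -> commute (F1 i) (F2 j)) ->
  (\prod_(i <- r) (F1 i * F2 i) = \prod_(i <- r) F1 i * \prod_(i <- r) F2 i)%g.
Proof.
move=> + FF; elim: r => [|i r IH] /=; first by rewrite !big_nil mulg1.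
move=> /andP[ir ur]; rewrite !big_cons IH // !mulgA; congr (_ * _)%g.
rewrite -!mulgA; congr (_ * _)%g; rewrite big_seq.
apply/commute_prod => j jr; apply/commute_sym/FF.
by apply: contraNneq ir => <-.
Qed.

Lemma prodg_single (I : eqType) (H : groupType) (r : seq I) (F : I -> H) i :
  uniq r -> i \in r -> (forall j, j != i -> F j = 1%g) -> (\prod_(j <- r) F j = F i)%g.
Proof.
move=> + + F1; elim: r => [|j r IH] //= /andP[jr ur]; rewrite inE big_cons.
case: eqVneq => [ij _|ij /= ir]; last by rewrite F1 ?mul1g ?IH // eq_sym.
rewrite -ij big_seq big1 ?mulg1 // => k kr; apply: F1.
by apply: contraNneq jr => ki; rewrite -ij -ki.
Qed.

(** Transport sees only the germs of the transition function. *)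
Lemma transport_near (R : realType) (X : topologicalType) (Gm : groupType)
    (d d' : X -> X -> Gm) (f : unit_interval R -> X) :
  continuous f -> transition d -> (forall z, \forall x \near z, d' z x = d z x) ->
  transport d' f = transport d f.
Proof.
move=> cf td dd'; have [g lg] := lift_of_path td cf.
rewrite (transportE lg); apply: transportE => q; near=> r.
rewrite /along; have -> : d' (f q) (f r) = d (f q) (f r).
  by near: r; exact: cf q _ (dd' (f q)).
by near: r; exact: lg.
Unshelve. all: by end_near. Qed.

(** Near the base point the values [d b0 x] are already trivial; making them trivial
    everywhere keeps the coordinates at rest from contributing to the products
    over all coordinates formed below. *)
Lemma orbit_space_normalized (R : realType) (G : groupType) (E B : topologicalType)
    (act : G -> E -> E) (p : E -> B) (b0 : B) :
  contractible R E -> covering_action act -> orbit_map act p ->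
  exists d : B -> B -> G,
  [/\ transition d, forall x, d b0 x = 1%g,
      \forall w \near b0, \forall x \near w, d w x = 1%g
    & bijective (monodromy d : pi1 R b0 -> G)].
Proof.
move=> cE cact omap; have [d [td db bd]] := orbit_space_transition b0 cE cact omap.
pose d' z x := if z == b0 then 1%g else d z x.
have dd' z : \forall x \near z, d' z x = d z x.
  rewrite /d'; case: eqP => [->|_]; last exact: nearW.
  by have := nbhs_singleton db; apply: filterS => x ->.
have td' : transition d'.
  move=> z; near=> w.
  have ww : \forall x \near w, d z x = (d z w * d w x)%g by near: w; exact: td.
  have wd : \forall x \near w, d' z x = d z x.
    by near: w; exact: nbhs_interior (dd' z).
  have -> : d' z w = d z w by near: w; exact: dd'.
  near=> x; have -> : d' z x = d z x by near: x.
  have -> : d' w x = d w x by near: x; exact: dd'.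
  by near: x.
exists d'; split => //.
- by move=> x; rewrite /d' eqxx.
- near=> w; have dw : \forall x \near w, d w x = 1%g by near: w.
  by near=> x; rewrite /d'; case: eqP => // _; near: x.
- suff -> : (monodromy d' : pi1 R b0 -> G) = monodromy d by [].
  apply/funext; elim/pi1_ind => f; rewrite !monodromyE //.
  exact: transport_near (@cts_fun _ _ f) td dd'.
Unshelve. all: by end_near. Qed.

Section Isomorphism.
Variables (R : realType) (n : nat) (K : simplicial_complex n).
Variables (X : 'I_n -> topologicalType) (G : 'I_n -> groupType) (pt : forall i, X i).
Variable d : forall i, X i -> X i -> G i.
Arguments d : clear implicits.
Hypothesis td : forall i, transition (d i).
Hypothesis d_pt : forall i x, d i (pt i) x = 1%g.
Hypothesis d_near : forall i, \forall w \near pt i, \forall x \near w, d i w x = 1%g.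
Hypothesis d_bij : forall i, bijective (monodromy (d i) : pi1 R (pt i) -> G i).
Local Notation I := (unit_interval R).
Local Notation Z := (ZK K pt).
Local Notation GP := (graph_product (edge K) G).
Local Notation supp := (supp pt).

Lemma edge_face (s : {set 'I_n}) i j : s \in faces K -> i \in s -> j \in s -> i != j ->
  edge K i j.
Proof.
move=> sK si sj ij; rewrite /edge /= ij; apply: faces_sub sK _.
by apply/fintype.subsetP => k; rewrite !inE => /orP[] /eqP ->.
Qed.

Definition ZK_transition (z x : Z) : GP :=
  (\prod_(i <- enum 'I_n) gp_in (edge K) (d i (coord i z) (coord i x)))%g.

(** Multiplying the factors for [z, w] with those for [w, x] requires those with
    different indices to commute.  Indices in the support of [z] are pairwise joined
    by edges; for any other index the coordinate of [z] is the base point, so that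
    both factors are trivial when [w] and [x] are close to [z]. *)
Lemma ZK_transitionP : transition ZK_transition.
Proof.
move=> z.
have A : \forall w \near z, forall i, \forall x \near w,
    d i (coord i z) (coord i x) =
    (d i (coord i z) (coord i w) * d i (coord i w) (coord i x))%g.
  apply: (@filter_forall _ _ (fun i (w : Z) => \forall x \near w,
    d i (coord i z) (coord i x) =
    (d i (coord i z) (coord i w) * d i (coord i w) (coord i x))%g) (nbhs z) (nbhs_filter z)) => i.
  exact: (transition_comp (@ZK_coord_continuous _ K _ pt i) (@td i) z).
have B : \forall w \near z, forall i, i \notin supp (fun i => coord i z) ->
    \forall x \near w, d i (coord i w) (coord i x) = 1%g.
  apply: (@filter_forall _ _ (fun i (w : Z) => i \notin supp (fun i => coord i z) ->
    \forall x \near w, d i (coord i w) (coord i x) = 1%g) (nbhs z) (nbhs_filter z)) => i.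
  have [iz|iz] := boolP (i \in supp (fun i => coord i z)); first exact: nearW.
  pose U v := [set x | d i v x = 1%g].
  have dn : \forall w \near coord i z, \forall x \near w, U w x.
    by rewrite (supp_notin iz); exact: d_near.
  near=> w => _; have /(_ (U (coord i w))) := @ZK_coord_continuous _ K _ pt i w; apply.
  by near: w; exact: @ZK_coord_continuous _ K _ pt i z _ dn.
near=> w.
have Aw : forall i, \forall x \near w, d i (coord i z) (coord i x) =
    (d i (coord i z) (coord i w) * d i (coord i w) (coord i x))%g by near: w.
have Bw : forall i, i \notin supp (fun i => coord i z) ->
    \forall x \near w, d i (coord i w) (coord i x) = 1%g by near: w.
near=> x.
have Ax : forall i, d i (coord i z) (coord i x) =
    (d i (coord i z) (coord i w) * d i (coord i w) (coord i x))%g.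
  by near: x; exact: (filter_forall (nbhs_filter w) Aw).
rewrite /ZK_transition -prodgM_distinct ?enum_uniq //.
  by apply: eq_bigr => i _; rewrite -gp_inM Ax.
have Bx : forall i, i \notin supp (fun i => coord i z) -> d i (coord i w) (coord i x) = 1%g.
  near: x; apply: (@filter_forall _ _ (fun i (x : Z) => i \notin supp (fun i => coord i z) ->
    d i (coord i w) (coord i x) = 1%g) (nbhs w) (nbhs_filter w)) => i.
  have [iz|iz] := boolP (i \in supp (fun i => coord i z)); first exact: nearW.
  by have := Bw i iz; apply: filterS.
move=> i j ij; have [iz|/supp_notin iz] := boolP (i \in supp (fun i => coord i z)); last first.
  by rewrite iz d_pt gp_in1; exact/commute_sym/commute1.
have [jz|/Bx ->] := boolP (j \in supp (fun i => coord i z)); last by rewrite gp_in1; exact: commute1.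
by apply: gp_in_commute; exact: edge_face (supp_coord z) iz jz ij.
Unshelve. all: by end_near. Qed.

Lemma supp_dfwith i (x : X i) : supp (dfwith pt i x) \in faces K.
Proof.
apply: faces_sub (faces1 K i) _; apply: supp_sub => j; rewrite inE => ji.
by rewrite dfwithout // eq_sym.
Qed.

Definition axis i (x : X i) : Z := to_ZK (supp_dfwith x).

Lemma coord_axis i (x : X i) j : coord j (axis x) = dfwith pt i x j.
Proof. by []. Qed.

Lemma axis_continuous i : continuous (@axis i).
Proof.
apply: ZK_continuous => j; have [->|ji] := eqVneq j i.
  have -> : (fun x : X i => coord i (axis x)) = id.
    by apply/funext => x; rewrite coord_axis dfwithin.
  by move=> x; exact: cvg_id.
have -> : (fun x : X i => coord j (axis x)) = fun=> pt j.
  by apply/funext => x; rewrite coord_axis dfwithout // eq_sym.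
exact: cst_continuous.
Qed.

Lemma axis_pt i : axis (pt i) = ZK_pt K pt.
Proof.
apply: ZK_eq => j; rewrite coord_axis coord_pt.
by have [<-|ij] := eqVneq i j; [rewrite dfwithin|rewrite dfwithout].
Qed.

Definition axis_pi1 i : pi1 R (pt i) -> pi1 R (ZK_pt K pt) :=
  pi1_map (@axis_continuous i) (axis_pt i).

Lemma monodromy_axis i a :
  monodromy ZK_transition (@axis_pi1 i a) = gp_in (edge K) (monodromy (d i) a).
Proof.
elim/pi1_ind: a => p; rewrite /axis_pi1 pi1_mapE monodromyE; last exact: ZK_transitionP.
rewrite monodromyE //; have [g lg] := lift_of_path (@td i) (@cts_fun _ _ p).
rewrite (transportE lg) (_ : gp_in _ _ =
  ((gp_in (edge K) (g zero))^-1 * gp_in (edge K) (g one))%g); last first.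
  by apply: (@mulgI _ (gp_in (edge K) (g zero))); rewrite -gp_inM !mulVKg.
apply: (@transportE _ _ _ _ _ (fun t => gp_in (edge K) (g t))) => q.
have := lg q; apply: filterS => r ->; rewrite gp_inM; congr (_ * _)%g.
have E j (t : I) : coord j (loop_map (@axis_continuous i) (axis_pt i) p t) = dfwith pt i (p t) j.
  by [].
rewrite /along /ZK_transition (prodg_single (i := i)) ?mem_enum ?enum_uniq //.
  by rewrite !E !dfwithin.
by move=> j ji; rewrite !E !dfwithout 1?eq_sym // d_pt gp_in1.
Qed.

(** The product of the two loops is a map of the square whose boundary is their
    commutator. *)
Lemma axis_pi1_commute i j a b : edge K i j ->
  commute (@axis_pi1 i a) (@axis_pi1 j b).
Proof.
move=> /andP[ij ijK]; elim/pi1_ind: a => f; elim/pi1_ind: b => h.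
rewrite /commute /axis_pi1 !pi1_mapE !pi1_classM; apply/pi1_classP.
pose x (st : I * I) := dfwith (dfwith pt i (f st.1)) j (h st.2).
have xi st : x st i = f st.1 by rewrite /x dfwithout 1?eq_sym // dfwithin.
have xj st : x st j = h st.2 by rewrite /x dfwithin.
have xk st k : k != i -> k != j -> x st k = pt k.
  by move=> ki kj; rewrite /x !dfwithout // eq_sym.
have xK st : supp (x st) \in faces K.
  apply: faces_sub ijK _; apply: supp_sub => k; rewrite !inE negb_or => /andP[].
  exact: xk.
have ext (st : I * I) (z : Z) : (forall k, x st k = coord k z) -> z = to_ZK (xK st).
  by move=> xz; apply: ZK_eq => k; rewrite -xz.
apply: (@square_homotopic _ _ (fun st => to_ZK (xK st))).
- apply: ZK_continuous => k; have [->|ki] := eqVneq k i.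
    have -> : (fun st => coord i (to_ZK (xK st))) = f \o fst.
      by apply/funext => st; rewrite coord_to_ZK xi.
    by move=> st; apply: (@continuous_comp _ _ _ fst f); [exact: cvg_fst|exact: cts_fun].
  have [->|kj] := eqVneq k j.
    have -> : (fun st => coord j (to_ZK (xK st))) = h \o snd.
      by apply/funext => st; rewrite coord_to_ZK xj.
    by move=> st; apply: (@continuous_comp _ _ _ snd h); [exact: cvg_snd|exact: cts_fun].
  have -> : (fun st => coord k (to_ZK (xK st))) = fun=> pt k.
    by apply/funext => st; rewrite coord_to_ZK xk.
  exact: cst_continuous.
- move=> s; apply: ext => k; rewrite -[RHS]/(dfwith pt i (f s) k).
  have [<-|ki] := eqVneq i k; first by rewrite xi dfwithin.
  have [<-|kj] := eqVneq j k; first by rewrite xj dfwithout // path_zero.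
  by rewrite xk ?dfwithout // eq_sym.
- move=> s; apply: ext => k; rewrite -[RHS]/(dfwith pt j (h s) k).
  have [<-|kj] := eqVneq j k; first by rewrite xj dfwithin.
  have [<-|ki] := eqVneq i k; first by rewrite xi dfwithout 1?eq_sym // path_one.
  by rewrite xk ?dfwithout // eq_sym.
- move=> s; apply: ext => k; rewrite -[RHS]/(dfwith pt j (h s) k).
  have [<-|kj] := eqVneq j k; first by rewrite xj dfwithin.
  have [<-|ki] := eqVneq i k; first by rewrite xi dfwithout 1?eq_sym // path_zero.
  by rewrite xk ?dfwithout // eq_sym.
- move=> s; apply: ext => k; rewrite -[RHS]/(dfwith pt i (f s) k).
  have [<-|ki] := eqVneq i k; first by rewrite xi dfwithin.
  have [<-|kj] := eqVneq j k; first by rewrite xj dfwithout // path_one.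
  by rewrite xk ?dfwithout // eq_sym.
Qed.

Lemma graph_product_to_pi1 : exists Phi : GP -> pi1 R (ZK_pt K pt),
  [/\ {morph Phi : a b / (a * b)%g},
      forall i (a : pi1 R (pt i)), exists c, Phi c = axis_pi1 a
    & forall c, monodromy ZK_transition (Phi c) = c].
Proof.
have /(_ _)/cid-/all_sig[inv invP] : forall i, exists inv : G i -> pi1 R (pt i),
    cancel inv (monodromy (d i)) /\ cancel (monodromy (d i)) inv.
  by move=> i; have [inv ? ?] := d_bij i; exists inv.
have invM i : {morph inv i : g h / (g * h)%g}.
  move=> g h; apply: (can_inj (invP i).2).
  by rewrite (monodromyM (@td i)) !(invP i).1.
have [|i j g h ij|Phi [PhiM PhiE]] := @gp_universal _ (edge K) G
    (pi1 R (ZK_pt K pt)) (fun i g => axis_pi1 (inv i g)).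
- by move=> i g h; rewrite invM /axis_pi1 pi1_mapM.
- exact: axis_pi1_commute.
have Phi1 : Phi 1%g = 1%g by apply: (@mulgI _ (Phi 1%g)); rewrite -PhiM !mulg1.
exists Phi; split => // [i a|].
  by exists (gp_in (edge K) (monodromy (d i) a)); rewrite PhiE (invP i).2.
apply: gp_ind => [|i g a IH].
  apply: (@mulgI _ (monodromy ZK_transition (Phi 1%g))).
  by rewrite -(monodromyM ZK_transitionP) -PhiM !mulg1.
by rewrite PhiM (monodromyM ZK_transitionP) IH PhiE monodromy_axis (invP i).1.
Qed.

End Isomorphism.

(** * Generation by coordinate loops *)

Section Surjectivity.
Variables (R : realType) (n : nat) (K : simplicial_complex n).
Variables (X : 'I_n -> topologicalType) (pt : forall i, X i).
Local Notation I := (unit_interval R).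
Local Notation Z := (ZK K pt).
Local Notation z0 := (ZK_pt K pt).
Local Notation supp := (supp pt).
Local Notation zsupp z := (supp (fun i => coord i z)).

Lemma supp_pt : zsupp z0 = finset.set0.
Proof. by apply/setP => i; rewrite !inE coord_pt eqxx. Qed.

(** Any submonoid containing the coordinate loops; the image of the graph product will
    be taken for it. *)
Variable Im : set (pi1 R z0).
Hypothesis Im1 : Im 1%g.
Hypothesis ImM : forall a b, Im a -> Im b -> Im (a * b)%g.
Hypothesis Im_axis : forall i (a : pi1 R (pt i)), Im (axis_pi1 K a).

Definition restrict (A : pred 'I_n) (z : Z) (i : 'I_n) : X i :=
  if A i then coord i z else pt i.

Lemma coord_path_continuous i a b (p : {path I from a to b in Z}) :
  continuous (fun t => coord i (p t)).
Proof.
by move=> t; apply: (@continuous_comp _ _ _ p (coord i));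
  [exact: cts_fun|exact: ZK_coord_continuous].
Qed.

(** The coordinates are switched on one after the other: adding one more coordinate
    is the passage from a composite of two edges of a square to its diagonal.  All
    points of that square lie over the simplex [s]. *)
Lemma simplex_loop (s : {set 'I_n}) (l : {path I from z0 to z0}) :
  s \in faces K -> (forall t, zsupp (l t) \subset s) -> Im (pi1_class l).
Proof.
move=> sK ls.
have rK A z : supp (restrict A z) \in faces K.
  apply: faces_sub (supp_coord z) _; apply: supp_sub => i /supp_notin iz.
  by rewrite /restrict iz if_same.
pose lA A (t : I) : Z := to_ZK (rK A (l t)).
have clA A : continuous (lA A).
  apply: ZK_continuous => i.
  have -> : (fun t => coord i (lA A t)) = if A i then (fun t => coord i (l t)) else fun=> pt i.
    by apply/funext => t; rewrite /lA coord_to_ZK /restrict; case: ifP.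
  by case: ifP => _; [exact: coord_path_continuous|exact: cst_continuous].
have lA0 A : lA A zero = z0.
  by apply: ZK_eq => i; rewrite /lA coord_to_ZK /restrict path_zero coord_pt if_same.
have lA1 A : lA A one = z0.
  by apply: ZK_eq => i; rewrite /lA coord_to_ZK /restrict path_one coord_pt if_same.
pose L A : {path I from z0 to z0} := mk_path (clA A) (lA0 A) (lA1 A).
suff H (r : seq 'I_n) : Im (pi1_class (L (mem r))).
  have -> : l = L (mem (enum 'I_n)); last exact: H.
  apply/path_eqP => t; apply: ZK_eq => i.
  by rewrite -[RHS]/(restrict (mem (enum 'I_n)) (l t) i) /restrict /= mem_enum.
elim: r => [|i r IH].
  have -> : L (mem [::]) = cst_loop R z0; last exact: Im1.
  by apply/path_eqP => t; apply: ZK_eq => i; rewrite coord_pt.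
have [ir|ir] := boolP (i \in r).
  have -> : L (mem (i :: r)) = L (mem r); last by [].
  apply/path_eqP => t; apply: ZK_eq => j.
  rewrite -[LHS]/(restrict (mem (i :: r)) (l t) j) -[RHS]/(restrict (mem r) (l t) j).
  by rewrite /restrict /= inE; case: eqVneq => // ->; rewrite ir.
have cl0 : coord i (l zero) = pt i by rewrite path_zero.
have cl1 : coord i (l one) = pt i by rewrite path_one.
pose m : {path I from pt i to pt i} := mk_path (@coord_path_continuous i _ _ l) cl0 cl1.
suff -> : pi1_class (L (mem (i :: r))) = (pi1_class (L (mem r)) * axis_pi1 K (pi1_class m))%g.
  exact: ImM.
rewrite /axis_pi1 pi1_mapE pi1_classM; apply/pi1_classP.
pose x (st : I * I) j : X j := if j == i then coord j (l st.2) else restrict (mem r) (l st.1) j.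
have xK st : supp (x st) \in faces K.
  apply: faces_sub sK _; apply: supp_sub => j js.
  have js' t : coord j (l t) = pt j.
    apply: (@supp_notin _ _ pt (fun j => coord j (l t))).
    by apply: contraNN js; exact: (fintype.subsetP (ls t) j).
  by rewrite /x /restrict !js' !if_same.
apply: (@diagonal_homotopic _ _ (fun st => to_ZK (xK st))).
- apply: ZK_continuous => j.
  have -> : (fun st => coord j (to_ZK (xK st))) =
      if j == i then (fun t => coord j (l t)) \o snd
      else if mem r j then (fun t => coord j (l t)) \o fst else fun=> pt j.
    by apply/funext => st; rewrite coord_to_ZK /x /restrict; case: ifP => // _; case: ifP.
  case: ifP => _; last (case: ifP => _; last exact: cst_continuous).
    by move=> st; apply: (@continuous_comp _ _ _ snd); [exact: cvg_snd|exact: coord_path_continuous].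
  by move=> st; apply: (@continuous_comp _ _ _ fst); [exact: cvg_fst|exact: coord_path_continuous].
- move=> t; apply: ZK_eq => j; rewrite coord_to_ZK -[LHS]/(restrict (mem r) (l t) j) /x.
  case: eqVneq => // ->; rewrite path_zero coord_pt /restrict.
  by rewrite /= (negbTE ir).
- move=> t; apply: ZK_eq => j; rewrite coord_to_ZK -[LHS]/(dfwith pt i (coord i (l t)) j) /x.
  have [->|ji] := eqVneq j i; first by rewrite dfwithin.
  by rewrite dfwithout 1?eq_sym // /restrict path_one coord_pt if_same.
- move=> t; apply: ZK_eq => j; rewrite coord_to_ZK -[LHS]/(restrict (mem (i :: r)) (l t) j) /x.
  by rewrite /restrict /= inE; case: eqVneq.
Qed.

Section CanonicalPaths.
(** Paths to the base point that do not move the coordinates already there, so that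
    they stay over any simplex over which they start. *)
Variable k : forall i (x : X i), {path I from x to pt i}.
Arguments k : clear implicits.
Hypothesis k_pt : forall i t, k i (pt i) t = pt i.

Lemma base_path_supp (z : Z) (t : I) : supp (fun i => k i (coord i z) t) \subset zsupp z.
Proof. by apply: supp_sub => i /supp_notin ->. Qed.

Definition base_path_fun (z : Z) (t : I) : Z :=
  to_ZK (faces_sub (supp_coord z) (base_path_supp z t)).

Lemma base_path_continuous z : continuous (base_path_fun z).
Proof. by apply: ZK_continuous => i; exact: (@cts_fun _ _ (k i (coord i z))). Qed.

Lemma base_path_zero z : base_path_fun z zero = z.
Proof. by apply: ZK_eq => i; rewrite coord_to_ZK path_zero. Qed.

Lemma base_path_one z : base_path_fun z one = z0.
Proof. by apply: ZK_eq => i; rewrite coord_to_ZK path_one. Qed.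

Definition base_path z : {path I from z to z0} :=
  mk_path (@base_path_continuous z) (base_path_zero z) (base_path_one z).

Definition close_up (x y : Z) (p : {path I from x to y}) : pi1 R z0 :=
  pi1_class (concat (Defs.rev_path (base_path x)) (concat p (base_path y))).

Lemma close_up_homotopic (x y : Z) (p q : {path I from x to y}) :
  path_homotopic p q -> close_up p = close_up q.
Proof.
move=> pq; apply/pi1_classP; apply: concat_homotopic (path_homotopic_refl _) _.
exact: concat_homotopic pq (path_homotopic_refl _).
Qed.

Lemma close_up_concat (x y w : Z) (p : {path I from x to y}) (q : {path I from y to w}) :
  close_up (concat p q) = (close_up p * close_up q)%g.
Proof.
rewrite /close_up pi1_classM; apply/pi1_classP/path_homotopic_sym.
have refl := path_homotopic_refl.
apply: path_homotopic_trans (path_homotopic_sym (concatA _ _ _)) _.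
apply: concat_homotopic; first exact: refl.
apply: path_homotopic_trans (path_homotopic_sym (concatA _ _ _)) _.
apply: path_homotopic_trans (concatA _ _ _).
apply: concat_homotopic; first exact: refl.
apply: path_homotopic_trans (concatA _ _ _) _.
apply: path_homotopic_trans (concat1p _).
by apply: concat_homotopic; [exact: concatpV|exact: refl].
Qed.

Lemma simplex_close_up (s : {set 'I_n}) (x y : Z) (p : {path I from x to y}) :
  s \in faces K -> (forall t, zsupp (p t) \subset s) -> Im (close_up p).
Proof.
move=> sK ps; apply: (simplex_loop sK) => t.
have kx z u : zsupp z \subset s -> zsupp (base_path z u) \subset s.
  exact: fintype.subset_trans (base_path_supp z u).
have xs : zsupp x \subset s by have := ps zero; rewrite path_zero.
have ys : zsupp y \subset s by have := ps one; rewrite path_one.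
rewrite -[_ t]/(concat_fun (rev_fun (base_path x)) (concat_fun p (base_path y)) t).
rewrite /concat_fun; case: ifP => _; first exact: kx.
by case: ifP => _; [exact: ps|exact: kx].
Qed.

Lemma close_up_loop (x y : Z) (l : {path I from z0 to z0}) (p : {path I from x to y}) :
  x = z0 -> y = z0 -> p =1 l -> close_up p = pi1_class l.
Proof.
move=> ex ey; subst x y; move=> /path_eqP ->; rewrite /close_up.
have -> : base_path z0 = cst_loop R z0.
  by apply/path_eqP => t; apply: ZK_eq => i; exact: (k_pt i t).
have -> : Defs.rev_path (cst_loop R z0) = cst_loop R z0 by exact/path_eqP.
apply/pi1_classP; apply: path_homotopic_trans (concat1p _) _; exact: concatp1.
Qed.

(** The times [t] for which the initial segment up to [t], closed up, lies in [Im] form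
    a locally constant set: two such segments differ by a segment over one
    simplex. *)
Lemma local_simplex_loop (l : {path I from z0 to z0}) :
  (forall t : I, exists2 s, s \in faces K & \forall u \near t, zsupp (l u) \subset s) ->
  Im (pi1_class l).
Proof.
move=> lloc.
have cseg (a b : R) : continuous (fun t : I => l (clamp ((b - a) * ival t + a))).
  apply: comp_clamp_continuous; first exact: cts_fun.
  exact/affine_continuous/ival_continuous.
have seg0 (a b : R) : l (clamp ((b - a) * ival zero + a)) = l (clamp a).
  by rewrite ival0 mulr0 add0r.
have seg1 (a b : R) : l (clamp ((b - a) * ival one + a)) = l (clamp b).
  by rewrite ival1 mulr1 subrK.
pose seg (a b : R) : {path I from l (clamp a) to l (clamp b)} :=
  mk_path (cseg a b) (seg0 a b) (seg1 a b).
have segE a b t : seg a b t = l (clamp ((b - a) * ival t + a)) by [].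
pose P (t : I) := Im (close_up (seg 0 (ival t))).
suff P1 : P one.
  rewrite -(@close_up_loop _ _ l (seg 0 (ival one))) //.
  - exact: path_zero.
  - by rewrite ivalK path_one.
  - by move=> t; rewrite segE ival1 subr0 mul1r addr0 ivalK.
have P0 : P zero.
  apply: (@simplex_close_up finset.set0); first exact: faces0.
  move=> t; rewrite segE ival0 subrr mul0r add0r.
  by rewrite -[clamp 0]/zero path_zero supp_pt.
apply: (connected_locally_constant (@unit_interval_connected R) _ _ _ P0) => // t _.
have [s sK nls] := lloc t.
have [e e0 eJ] := near_unit_interval nls.
suff H t1 t2 : `|ival t - ival t1| < e -> `|ival t - ival t2| < e -> P t1 -> P t2.
  near=> u => _.
  have tu : `|ival t - ival u| < e by near: u; exact: unit_interval_near.
  by split; apply: H; rewrite ?subrr ?normr0.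
move=> t1e t2e Pt1; rewrite /P.
have -> : close_up (seg 0 (ival t2)) =
    (close_up (seg 0 (ival t1)) * close_up (seg (ival t1) (ival t2)))%g.
  rewrite -close_up_concat; apply: close_up_homotopic.
  apply: (@diagonal_homotopic _ _ (fun st => l (clamp
    (ival t1 * ival st.1 + 0 + ((ival t2 - ival t1) * ival st.2 + 0))))).
  - apply: comp_clamp_continuous; first exact: cts_fun.
    move=> st; apply: cvgD.
      apply: (@affine_continuous _ _ (fun st : I * I => ival st.1)) => {}st.
      by apply: (@continuous_comp _ _ _ fst); [exact: cvg_fst|exact: ival_continuous].
    apply: (@affine_continuous _ _ (fun st : I * I => ival st.2)) => {}st.
    by apply: (@continuous_comp _ _ _ snd); [exact: cvg_snd|exact: ival_continuous].
  - by move=> u; rewrite segE /= ival0; congr (l (clamp _)); lra.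
  - by move=> u; rewrite segE /= ival1; congr (l (clamp _)); lra.
  - by move=> u; rewrite segE /=; congr (l (clamp _)); lra.
apply: ImM => //; apply: (simplex_close_up sK) => u; rewrite segE; apply: eJ.
have := ival_ge0 u; have := ival_le1 u => u1 u0.
have [t1u t2u] : 0 <= 1 - ival u /\ 0 <= ival u by split; lra.
have := ival_ge0 t1; have := ival_le1 t1; have := ival_ge0 t2; have := ival_le1 t2.
move=> h1 h2 h3 h4; set q := (_ * _ + _).
have [q1 q2] : Num.min (ival t1) (ival t2) <= q /\ q <= Num.max (ival t1) (ival t2).
  rewrite /q; case: (leP (ival t1) (ival t2)) => h.
    have h12 : 0 <= ival t2 - ival t1 by lra.
    by have a := mulr_ge0 h12 u0; have b := mulr_ge0 h12 t1u; split; lra.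
  have h21 : 0 <= ival t1 - ival t2 by lra.
  by have a := mulr_ge0 h21 u0; have b := mulr_ge0 h21 t1u; split; lra.
clearbody q; move: q1 q2 t1e t2e; rewrite !ltr_norml; case: (leP (ival t1) (ival t2)) => h q1 q2 *;
  by rewrite clampK; lra.
Unshelve. all: by end_near. Qed.

Variable h : forall i, X i * R -> X i.
Variable U : forall i, set (X i).
Arguments h : clear implicits.
Arguments U : clear implicits.
Hypothesis h_continuous : forall i, continuous (h i).
Hypothesis h0 : forall i x, h i (x, 0) = x.
Hypothesis h_pt : forall i t, h i (pt i, t) = pt i.
Hypothesis U_pt : forall i, nbhs (pt i) (U i).
Hypothesis h1 : forall i x, U i x -> h i (x, 1) = pt i.

Lemma collapse_supp (z : Z) (t : R) : supp (fun i => h i (coord i z, t)) \subset zsupp z.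
Proof. by apply: supp_sub => i /supp_notin ->. Qed.

Definition collapse (z : Z) (t : R) : Z :=
  to_ZK (faces_sub (supp_coord z) (collapse_supp z t)).

(** After the collapse, a loop remains for a while over the simplex of the point where
    the original loop was, as the coordinates that were at the base point have not
    left its collapsing neighbourhood. *)
Lemma loop_in_Im (l : {path I from z0 to z0}) : Im (pi1_class l).
Proof.
pose H (st : I * I) := collapse (l st.1) (ival st.2).
have cH : continuous H.
  apply: ZK_continuous => i.
  move=> st; apply: (@continuous_comp _ _ _ (fun st : I * I => (coord i (l st.1), ival st.2)) (h i));
    last exact: h_continuous.
  apply: continuous_pair => {}st.
    by apply: (@continuous_comp _ _ _ fst (fun t => coord i (l t)));
      [exact: cvg_fst|exact: coord_path_continuous].
  by apply: (@continuous_comp _ _ _ snd (@ival R)); [exact: cvg_snd|exact: ival_continuous].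
have collapse_z0 t : collapse z0 t = z0.
  by apply: ZK_eq => i; rewrite coord_to_ZK coord_pt h_pt.
have cl1 : continuous (fun s => H (s, one)).
  by move=> s; apply: (@continuous_comp _ _ _ (fun s => (s, one)) H);
    [exact: continuous_pairl|exact: cH].
have l0 : H (zero, one) = z0 by rewrite /H path_zero collapse_z0.
have l1 : H (one, one) = z0 by rewrite /H path_one collapse_z0.
pose l' : {path I from z0 to z0} := mk_path cl1 l0 l1.
have -> : pi1_class l = pi1_class l'.
  apply/pi1_classP; exists H; split => //.
  - by move=> s; apply: ZK_eq => i; rewrite coord_to_ZK ival0 h0.
  - by move=> t; rewrite /H path_zero collapse_z0.
  - by move=> t; rewrite /H path_one collapse_z0.
apply: local_simplex_loop => t; exists (zsupp (l t)); first exact: supp_coord.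
have N : \forall u \near t, forall i, coord i (l t) = pt i -> U i (coord i (l u)).
  apply: (@filter_forall _ _ (fun i u => coord i (l t) = pt i -> U i (coord i (l u)))
    (nbhs t) (nbhs_filter t)) => i.
  have [lt|lt] := pselect (coord i (l t) = pt i); last by apply: nearW => u /lt.
  have Un : nbhs (coord i (l t)) (U i) by rewrite lt.
  near=> u => _; near: u; exact: (@coord_path_continuous i _ _ l t _ Un).
near=> u; apply: supp_sub => i /supp_notin it.
have uU : forall i, coord i (l t) = pt i -> U i (coord i (l u)) by near: u.
by rewrite -[LHS]/(h i (coord i (l u), ival one)) ival1 h1 //; exact: uU.
Unshelve. all: by end_near. Qed.

End CanonicalPaths.
End Surjectivity.

(** * The isomorphisms *)

Lemma edge_skeleton n (K : simplicial_complex n) : edge (skeleton K 1) = edge K.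
Proof.
apply/funext => i; apply/funext => j; rewrite /edge /= /skeleton_faces inE.
by case: eqP => //= _; rewrite cards2; case: (_ \in _) => //=; case: eqP.
Qed.

Lemma morph_isomorphic (G H : groupType) (f : G -> H) :
  {morph f : a b / (a * b)%g} -> bijective f -> group_isomorphic G H.
Proof.
move=> fM bf; pose fm := isMultiplicative.Build G H f fM.
by exists (HB.pack_for {multiplicative G -> H} f fm).
Qed.

Lemma pi1_ZK (R : realType) (n : nat) (K : simplicial_complex n)
    (G : 'I_n -> groupType) (X : 'I_n -> topologicalType) (pt : forall i, X i) :
  (forall i, classifying_space R (G i) (pt i)) ->
  exists (Psi : pi1 R (ZK_pt K pt) -> graph_product (edge K) G) Phi,
  [/\ {morph Psi : a b / (a * b)%g}, {morph Phi : a b / (a * b)%g},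
     cancel Psi Phi & cancel Phi Psi].
Proof.
move=> cX.
have /(_ _)/cid-/all_sig[d dP] : forall i, exists d : X i -> X i -> G i,
    [/\ transition d, forall x, d (pt i) x = 1%g,
      \forall w \near pt i, \forall x \near w, d w x = 1%g
    & bijective (monodromy d : pi1 R (pt i) -> G i)].
  move=> i; have [_ [E [act [p [cE cact omap]]]]] := cX i.
  exact: orbit_space_normalized cE cact omap.
have /(_ _)/cid-/all_sig[k kP] : forall i, exists k : forall x : X i,
    {path unit_interval R from x to pt i}, forall t, k (pt i) t = pt i.
  move=> i; have [_ [E [act [p [cE cact omap]]]]] := cX i.
  have path_ex (x : X i) : exists k : {path unit_interval R from x to pt i},
      x = pt i -> forall t, k t = pt i.
    have [->|xpt] := pselect (x = pt i).
      by exists (cst_loop R (pt i)).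
    by have [k _] := orbit_space_path (pt i) cE omap x; exists k.
  have /(_ _)/cid-/all_sig[k kP] := path_ex.
  by exists k => t; exact: kP.
have /(_ _)/cid-/all_sig[h /(_ _)/cid-/all_sig[U hP]] : forall i,
    exists (h : X i * R -> X i) (U : set (X i)),
    [/\ continuous h, forall x, h (x, 0) = x, forall t, h (pt i, t) = pt i,
      nbhs (pt i) U & forall x, U x -> h (x, 1) = pt i].
  by move=> i; apply: cw_point_collapse; case: (cX i).
have td i : transition (d i) by case: (dP i).
have dpt i : forall x, d i (pt i) x = 1%g by case: (dP i).
have dn i : \forall w \near pt i, \forall x \near w, d i w x = 1%g by case: (dP i).
have db i : bijective (monodromy (d i) : pi1 R (pt i) -> G i) by case: (dP i).
have [Phi [PhiM Phiax PsiPhi]] := @graph_product_to_pi1 R n K X G pt d td dpt dn db.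
have Phi1 : Phi 1%g = 1%g by apply: (@mulgI _ (Phi 1%g)); rewrite -PhiM !mulg1.
exists (monodromy (@ZK_transition n K X G pt d)), Phi; split => //.
  have tZ := @ZK_transitionP n K X G pt d td dpt dn.
  exact: (@monodromyM R _ _ _ tZ).
have surj a : exists c, Phi c = a.
  elim/pi1_ind: a => l.
  have hc i : continuous (h i) by case: (hP i).
  have h0 i : forall x, h i (x, 0) = x by case: (hP i).
  have hpt i : forall t, h i (pt i, t) = pt i by case: (hP i).
  have Upt i : nbhs (pt i) (U i) by case: (hP i).
  have h1 i : forall x, U i x -> h i (x, 1) = pt i by case: (hP i).
  apply: (@loop_in_Im R n K X pt [set a | exists c, Phi c = a] _ _ _ k kP h U
    hc h0 hpt Upt h1).
  - by exists 1%g.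
  - by move=> _ _ [a <-] [b <-]; exists (a * b)%g; rewrite PhiM.
  - exact: Phiax.
by move=> a; have [c <-] := surj a; rewrite PsiPhi.
Qed.

Theorem proposition1p2 (R : realType) (n : nat) (K : simplicial_complex n)
    (G : 'I_n -> groupType) (BG : 'I_n -> topologicalType)
    (pt : forall i, BG i)
    (BG_classifying : forall i, classifying_space R (G i) (pt i)) :
  group_isomorphic (pi1 R (ZK_pt K pt)) (pi1 R (ZK_pt (skeleton K 1) pt)) /\
  group_isomorphic (pi1 R (ZK_pt (skeleton K 1) pt))
    (graph_product (edge (skeleton K 1)) G).
Proof.
have [Psi1 [Phi1 [Psi1M Phi1M PsiK1 PhiK1]]] := pi1_ZK (skeleton K 1) BG_classifying.
split; last by apply: (morph_isomorphic Psi1M); exists Phi1.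
move: Psi1 Phi1 Psi1M Phi1M PsiK1 PhiK1; rewrite edge_skeleton => Psi1 Phi1 _ Phi1M PsiK1 PhiK1.
have [Psi [Phi [PsiM PhiM PsiK PhiK]]] := pi1_ZK K BG_classifying.
apply: (@morph_isomorphic _ _ (Phi1 \o Psi)).
  by move=> a b /=; rewrite PsiM Phi1M.
by exists (Phi \o Psi1); [exact: can_comp PhiK1 PsiK|exact: can_comp PhiK PsiK1].
Qed.
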